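(* Let $n\ge1$ be an integer and consider the piecewise smooth classical Liénard system $$\begin{cases}\dot x=y-F_-(x),\\ \dot y=-\epsilon a_1^-x,\end{cases}\ x\le0,\qquad \begin{cases}\dot x=y-F_+(x),\\ \dot y=-\epsilon a_1^+x,\end{cases}\ x\ge0,$$ $$F_-(x)=(-1)^{n+1}x^{n+1}+\sum_{k=2}^nb_k^-x^k,\qquad F_+(x)=x^{n+1}+\sum_{k=2}^nb_k^+x^k,$$ where $0<\epsilon\ll1$, $a_1^\pm>0$, $b_2^\pm>0$ (if $n=1$, the sums are empty and the last condition is void), and assume $F_-'(x)<0$ for all $x<0$ and $F_+'(x)>0$ for all $x>0$. Let $H$ be the associated slow relation function and $I=I_+-I_-$ the difference of the slow divergence integrals, and suppose that $y^*>0$ is large and $I$ is nonzero on $]y^*,\infty[$. Put $f_k=b_k^++(-1)^{k+1}b_k^-$ for $k=2,\dots,n$ and, if some $f_k$ is nonzero, let $k_0$ be the maximal $k$ with $f_k\ne0$. Given $y_0\in\,]y^*,\infty[$, the following statements hold. 1. Suppose $a_1^-\ne a_1^+$. If $a_1^->a_1^+$ (resp. $a_1^-<a_1^+$), then the orbit $U=\{y_l\mid l\in\mathbb N\}$ of $y_0$ by $H$ (resp. $H^{-1}$) tends monotonically to $+\infty$ and $\dim_BU=0$. 2. Suppose that $a_1^-=a_1^+$ and that one of the coefficients $f_k$ is nonzero with $k_0\ne n-1$. If $f_{k_0}(1+k_0-n)>0$ (resp. $f_{k_0}(1+k_0-n)<0$), then the orbit $U=\{y_l\mid l\in\mathbb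 N\}$ of $y_0$ by $H$ (resp. $H^{-1}$) tends monotonically to $+\infty$, $U$ is Minkowski nondegenerate and $$\dim_BU=\frac{n+1-k_0}{n+2-k_0}.$$ These results do not depend on the choice of the initial point $y_0$.
   Context: Slow divergence integrals: for $y>0$ let $\alpha(y)<0<\omega(y)$ be the unique points with $F_-(\alpha(y))=y=F_+(\omega(y))$, and with $G_\pm(x)=-a_1^\pm x$ put $$I_-(y)=-\int_{\alpha(y)}^{0}\frac{F_-'(x)^2}{G_-(x)}\,dx<0,\qquad I_+(y)=-\int_{\omega(y)}^{0}\frac{F_+'(x)^2}{G_+(x)}\,dx<0,\qquad I(y)=I_+(y)-I_-(y).$$ $I_\pm$ are strictly decreasing bijections from $]0,\infty[$ to $]-\infty,0[$. The slow relation function $H:\,]0,\infty[\to]0,\infty[$ is defined by $I_-(H(y))=I_+(y)$. The orbit of $y_0$ by $H$ is given by $I_-(y_{l+1})=I_+(y_l)$, $l\ge0$, and the orbit by $H^{-1}$ by $I_-(y_l)=I_+(y_{l+1})$, $l\ge0$. Minkowski dimension of an orbit $U$ tending to $+\infty$: by definition $\dim_BU$ (and its lower and upper versions), and Minkowski nondegeneracy, are those of the bounded set $\{y_l^{-1/(n+1)}\mid l\in\mathbb N\}\subset\mathbb R$. For bounded $V\subset\mathbb R$ let $|V_\delta|$ be the Lebesgue measure of the closed $\delta$-neighborhood $V_\delta=\{x:\mathrm{dist}(x,V)\le\delta\}$. For $s\ge0$ put $\mathcal M_*^s(V)=\liminf_{\delta\to0}|V_\delta|/\delta^{1-s}$ and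 $\mathcal M^{*s}(V)=\limsup_{\delta\to0}|V_\delta|/\delta^{1-s}$; $\underline\dim_BV=\inf\{s\ge0:\mathcal M_*^s(V)=0\}$, $\overline\dim_BV=\inf\{s\ge0:\mathcal M^{*s}(V)=0\}$. If they coincide, the common value is $\dim_BV$. $V$ is Minkowski nondegenerate if there is $d$ with $0<\mathcal M_*^d(V)\le\mathcal M^{*d}(V)<\infty$ (then $d=\dim_BV$). *)

(* Defs.v *)
From HB Require Import structures.
From mathcomp Require Import all_boot all_order all_algebra.
From mathcomp Require Import all_classical all_reals all_analysis.
Set Implicit Arguments.
Unset Strict Implicit.
Unset Printing Implicit Defensive.
Import Order.TTheory GRing.Theory Num.Theory.
Import numFieldNormedType.Exports.
Local Open Scope classical_set_scope.
Local Open Scope ring_scope.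

Section Minkowski.
Context {R : realType}.
Implicit Types (V : set R) (s d : R).

(* [edist_inf V x] is dist(x, V) as an extended real (+oo when V is empty). *)
Definition closed_nbhd V (delta : R) : set R :=
  [set x | (edist_inf V x <= delta%:E)%E].

Definition minkowski_quotient s V (delta : R) : \bar R :=
  (lebesgue_measure (closed_nbhd V delta) * ((delta `^ (1 - s))^-1)%:E)%E.

Definition lower_minkowski_content s V : \bar R :=
  limf_einf (minkowski_quotient s V) 0^'+.

Definition upper_minkowski_content s V : \bar R :=
  limf_esup (minkowski_quotient s V) 0^'+.

(* The infima are taken in the extended reals, so that the infimum of an empty
   set is +oo rather than a default real value. *)
Definition lower_box_dim V : \bar R :=
  ereal_inf [set s%:E | s in
    [set s | 0 <= s /\ lower_minkowski_content s V = 0%E]].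

Definition upper_box_dim V : \bar R :=
  ereal_inf [set s%:E | s in
    [set s | 0 <= s /\ upper_minkowski_content s V = 0%E]].

Definition has_box_dim V d : Prop :=
  lower_box_dim V = d%:E /\ upper_box_dim V = d%:E.

Definition minkowski_nondegenerate V : Prop :=
  exists d, [/\ 0 <= d,
    (0 < lower_minkowski_content d V)%E,
    (lower_minkowski_content d V <= upper_minkowski_content d V)%E &
    (upper_minkowski_content d V < +oo)%E].

(* Sequences tending to +oo are measured after the substitution
   y |-> y^(-1/(n+1)), which makes them bounded. *)
Definition orbit_at_infinity (n : nat) (U : set R) : set R :=
  [set y `^ (- (n.+1%:R)^-1) | y in U].

End Minkowski.

Section SlowDivergence.
Context {R : realType}.
Implicit Types (n : nat) (a x y : R) (b : nat -> R) (F G J : R -> R).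

(* The system is x' = y - F(x), y' = eps * G(x), with F, G taken to be
   Fminus, Gfun a_1^- for x <= 0 and Fplus, Gfun a_1^+ for x >= 0. The slow
   divergence integrals and the slow relation do not involve eps.
   Only the values [b k] with 2 <= k <= n are used. *)
Definition Fminus n b x : R :=
  (-1) ^+ n.+1 * x ^+ n.+1 + \sum_(2 <= k < n.+1) b k * x ^+ k.

Definition Fplus n b x : R :=
  x ^+ n.+1 + \sum_(2 <= k < n.+1) b k * x ^+ k.

Definition Gfun a x : R := - a * x.

Definition oriented_integral (u v : R) (f : R -> R) : R :=
  if u <= v then \int[lebesgue_measure]_(x in `[u, v]) f x
  else - \int[lebesgue_measure]_(x in `[v, u]) f x.

Definition slow_divergence_integral F G (x0 : R) : R :=
  - oriented_integral x0 0 (fun x => derive1 F x ^+ 2 / G x).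

(* In the definitions by [xget 0] below, the point sought exists and is unique
   for y > 0 under the assumptions made on the system; 0 is a dummy default. *)
Definition alpha n b y : R := xget 0 [set x | x < 0 /\ Fminus n b x = y].
Definition omega n b y : R := xget 0 [set x | 0 < x /\ Fplus n b x = y].

Definition Iminus n a b y : R :=
  slow_divergence_integral (Fminus n b) (Gfun a) (alpha n b y).
Definition Iplus n a b y : R :=
  slow_divergence_integral (Fplus n b) (Gfun a) (omega n b y).

(* H and its inverse: Jm (H y) = Jp y and Jm y = Jp (H^-1 y). *)
Definition slow_relation (Jm Jp : R -> R) y : R :=
  xget 0 [set z | 0 < z /\ Jm z = Jp y].
Definition slow_relation_inv (Jm Jp : R -> R) y : R :=
  xget 0 [set z | 0 < z /\ Jm y = Jp z].

Definition orbit_of (h : R -> R) y0 : nat -> R := fun l => iter l h y0.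

Definition fcoef (bm bp : nat -> R) (k : nat) : R :=
  bp k + (-1) ^+ k.+1 * bm k.

Definition tends_monotonically_to_infinity (u : nat -> R) : Prop :=
  nondecreasing_seq u /\ u l @[l --> \oo] --> +oo.

End SlowDivergence.

(* Main.v *)
Require Import Defs.
From HB Require Import structures.
From mathcomp Require Import all_boot all_order all_algebra.
From mathcomp Require Import all_classical all_reals all_analysis.
From mathcomp Require Import polyrcf ring lra zify.
Set Implicit Arguments.
Unset Strict Implicit.
Unset Printing Implicit Defensive.
Import Order.TTheory GRing.Theory Num.Theory.
Import numFieldNormedType.Exports.
Local Open Scope classical_set_scope.
Local Open Scope ring_scope.

(** Substituting x = - t on the left half-plane turns F_- into a polynomial A(t)
which, like B = F_+ on the right, is monic of degree n + 1, has no constant or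
linear term and increases on t > 0.  Writing A'(t) = t Q_A(t), the integrand of
the slow divergence integral becomes a constant multiple of t Q_A(t)^2, so that
I_-(y) = - D_A(s_A(y)) / a_1^-, where the polynomial D_A is the primitive of
A' Q_A vanishing at 0 and s_A is the inverse of A on the half-line; the same
holds for I_+ with B.  Both the slow relation and its inverse are therefore
maps h given by D_A(s_A(h y)) / a = D_B(s_B(y)) / b, up to exchanging the two
sides.

An orbit of h that starts where I has no zero is monotone, because I keeps the
sign it has near infinity, and it is unbounded, because a limit would be a zero
of I ([orbit_escapes]).

Put v = y^(1/(n+1)).  At infinity v, s_A(y) and s_B(y) are equivalent, and the
set to be measured consists of the points 1 / v_l of the orbit.
- If a > b, comparing the leading terms of D_A and D_B, which are equal and of
  degree 2 n, gives (v(h y) / v(y))^(2 n) -> a / b > 1: the sequence v_l grows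
  geometrically ([geometric_return]).
- If a = b, let f t^k0 be the leading term of B - A.  Cauchy's mean value
  theorem, applied to D and to A or B, makes D_A(s_A(h y)) - D_A(s_A(y))
  equivalent to an explicit multiple of f (1 + k0 - n) t^(k0 + n - 1) at
  t = s_A(y).  Two more uses of the same theorem turn this into the convergence
  of v(h y)^m - v(y)^m to a positive number, with m = n + 1 - k0
  ([nroot_increment_cvg]): v_l^m grows linearly.

The dimension is read off such increments.  If v_{l+1}^m - v_l^m stays above a
positive constant, at most O(r^(-m)) points 1 / v_l exceed r; choosing
r = e^(1/(m+1)), the intervals of radius e around them and the interval [0, r]
have total length O(r) ([measure_nbhd_upper]).  If the increments stay bounded,
the gaps between the points 1 / v_l below c r are smaller than e, so that the
neighbourhood contains a whole interval of length of order r
([measure_nbhd_lower]).  Hence the dimension is 1 - 1/(m+1) = m/(m+1) when v_l^m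
grows linearly, and 0 when v_l grows geometrically, since the upper estimate
then holds for every m > 0. *)

(** * Monotonicity of real powers *)

Section PowR.
Context {R : realType}.
Implicit Types (x y r : R).

Lemma le_powR r x y : 0 <= r -> 0 <= x -> x <= y -> x `^ r <= y `^ r.
Proof. by move=> r0 x0 xy; rewrite ge0_ler_powR ?nnegrE// (le_trans x0). Qed.

Lemma lt_powR r x y : 0 < r -> 0 <= x -> x < y -> x `^ r < y `^ r.
Proof. by move=> r0 x0 xy; rewrite gt0_ltr_powR ?nnegrE// (le_trans x0)// ltW. Qed.

End PowR.

(** * Minkowski contents and box dimensions from bounds on neighbourhoods *)

Section Contents.
Context {R : realType}.
Implicit Types (V : set R) (s d C : R).

(** A closed set, being a sublevel set of the continuous distance to [V]. *)
Lemma measurable_closed_nbhd V (e : R) : measurable (closed_nbhd V e).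
Proof.
apply: measurable_realfun.closed_measurable.
have := @closed_ereal_ge_ereal R e%:E.
by apply: preimage_closed => x _; exact: edist_inf_continuous.
Qed.

(** The distance to [V] need not be attained; the factor 2 leaves room for
an approximate minimizer. *)
Lemma closed_nbhd_near V (e x : R) : 0 < e -> closed_nbhd V e x ->
  exists2 a, V a & `|x - a| < 2 * e.
Proof.
move=> e0 /= xV.
have : (edist_inf V x < (2 * e)%:E)%E.
  by apply: le_lt_trans xV _; rewrite lte_fin; lra.
by move=> /ereal_inf_lt[_ [a Va <-]] /edist_lt_ball; exists a.
Qed.

Lemma near_closed_nbhd V (e x a : R) : 0 < e -> V a -> `|x - a| < e ->
  closed_nbhd V e x.
Proof.
move=> e0 Va xa; rewrite /closed_nbhd /=.
apply: (@le_trans _ _ (edist (x, a))); first by apply: ereal_inf_lbound; exists a.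
exact: edist_fin.
Qed.

Lemma minkowski_quotient_ge0 s V (e : R) : (0 <= minkowski_quotient s V e)%E.
Proof. by rewrite /minkowski_quotient mule_ge0// lee_fin invr_ge0 powR_ge0. Qed.

Lemma upper_content_le s V C :
  (\forall e \near 0^'+, (minkowski_quotient s V e <= C%:E)%E) ->
  (upper_minkowski_content s V <= C%:E)%E.
Proof.
move=> H; rewrite /upper_minkowski_content limf_esupE.
apply: ge_ereal_inf; exists (ereal_sup (minkowski_quotient s V @`
   [set e | (minkowski_quotient s V e <= C%:E)%E])).
  by exists [set e | (minkowski_quotient s V e <= C%:E)%E].
by apply: ge_ereal_sup => _ [e /= + <-].
Qed.

Lemma lower_content_ge s V C :
  (\forall e \near 0^'+, (C%:E <= minkowski_quotient s V e)%E) ->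
  (C%:E <= lower_minkowski_content s V)%E.
Proof.
move=> H; rewrite /lower_minkowski_content limf_einfE.
apply: le_ereal_sup_tmp; exists (ereal_inf (minkowski_quotient s V @`
   [set e | (C%:E <= minkowski_quotient s V e)%E])).
  by exists [set e | (C%:E <= minkowski_quotient s V e)%E].
by apply: le_ereal_inf_tmp => _ [e /= + <-].
Qed.

Lemma lower_content_le_upper s V :
  (lower_minkowski_content s V <= upper_minkowski_content s V)%E.
Proof.
rewrite /lower_minkowski_content /upper_minkowski_content limf_einfE limf_esupE.
apply: ge_ereal_sup => _ [A FA <-]; apply: le_ereal_inf_tmp => _ [B FB <-].
have [e [Ae Be]] : (A `&` B) !=set0 by apply: (@filter_ex _ 0^'+); exact: filterI.
apply: (@le_trans _ _ (minkowski_quotient s V e)).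
  by apply: ereal_inf_lbound; exists e.
by apply: ereal_sup_ubound; exists e.
Qed.

Lemma upper_content_ge0 s V : (0 <= upper_minkowski_content s V)%E.
Proof.
apply: limf_esup_ge0; last exact: minkowski_quotient_ge0.
by move=> /filter_ex[].
Qed.

Lemma near_powR_le (a e : R) : 0 < a -> 0 < e -> \forall x \near 0^'+, x `^ a <= e.
Proof.
move=> a0 e0; have e'0 : 0 < e `^ (a^-1) by rewrite powR_gt0.
near=> x; have x0 : 0 < x by near: x; exact: nbhs_right_gt.
rewrite -[leRHS]powRr1 ?(ltW e0)// -(mulVf (lt0r_neq0 a0)) powRrM.
apply: le_powR; rewrite ?(ltW a0) ?(ltW x0)//.
by apply: ltW; near: x; exact: nbhs_right_lt.
Unshelve. all: by end_near. Qed.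

Lemma upper_content_le_bound d V C :
  (\forall e \near 0^'+,
    (lebesgue_measure (closed_nbhd V e) <= (C * e `^ (1 - d))%:E)%E) ->
  (upper_minkowski_content d V <= C%:E)%E.
Proof.
move=> H; apply: upper_content_le; near=> e.
have e0 : 0 < e by near: e; exact: nbhs_right_gt.
by rewrite /minkowski_quotient lee_pdivrMr ?powR_gt0// -?EFinM; near: e.
Unshelve. all: by end_near. Qed.

(** Passing from [d] to [s > d] multiplies the quotient by [e `^ (s - d)], which
tends to 0. *)
Lemma upper_content_eq0 d V C : 0 <= C ->
  (\forall e \near 0^'+,
    (lebesgue_measure (closed_nbhd V e) <= (C * e `^ (1 - d))%:E)%E) ->
  forall s, d < s -> upper_minkowski_content s V = 0%E.
Proof.
move=> C0 H s ds; apply/eqP; rewrite eq_le upper_content_ge0 andbT.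
apply/lee_addgt0Pr => e e0; rewrite add0e.
have C1 : 0 < C + 1 by lra.
apply: upper_content_le; near=> x.
have x0 : 0 < x by near: x; exact: nbhs_right_gt.
rewrite /minkowski_quotient lee_pdivrMr ?powR_gt0// -?EFinM.
apply: (@le_trans _ _ (C * x `^ (1 - d))%:E); first by near: x.
rewrite lee_fin (_ : 1 - d = (s - d) + (1 - s)); last by ring.
rewrite powRD ?(gt_eqF x0) ?implybT// mulrA ler_wpM2r ?powR_ge0//.
apply: (@le_trans _ _ ((C + 1) * x `^ (s - d))).
  by rewrite ler_wpM2r ?powR_ge0//; lra.
rewrite mulrC -ler_pdivlMr//; near: x; apply: near_powR_le; last by rewrite divr_gt0.
by rewrite subr_gt0.
Unshelve. all: by end_near. Qed.

(** For [e < 1] the quotient can only grow when [d] is replaced by a smaller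
exponent. *)
Lemma lower_content_ge_bound d V C : 0 < C ->
  (\forall e \near 0^'+,
    ((C * e `^ (1 - d))%:E <= lebesgue_measure (closed_nbhd V e))%E) ->
  forall s, s <= d -> (C%:E <= lower_minkowski_content s V)%E.
Proof.
move=> C0 H s sd; apply: lower_content_ge; near=> x.
have x0 : 0 < x by near: x; exact: nbhs_right_gt.
have x1 : x < 1 by near: x; exact: nbhs_right_lt.
rewrite /minkowski_quotient lee_pdivlMr ?powR_gt0// -?EFinM.
apply: (@le_trans _ _ (C * x `^ (1 - d))%:E); last by near: x.
rewrite lee_fin (ler_wpM2l (ltW C0))// ger_powR ?x0 ?(ltW x1)//; lra.
Unshelve. all: by end_near. Qed.

(** If the upper content vanishes at [s], so does the lower one. *)
Lemma lower_le_upper_box_dim V : (lower_box_dim V <= upper_box_dim V)%E.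
Proof.
apply: ereal_inf_le_tmp => _ [s [s0 us] <-]; exists s => //; split=> //.
apply/eqP; rewrite eq_le -{1}us lower_content_le_upper /=.
apply: lower_content_ge; near=> e; exact: minkowski_quotient_ge0.
Unshelve. all: by end_near. Qed.

Lemma upper_box_dim_le d V : 0 <= d ->
  (forall s, d < s -> upper_minkowski_content s V = 0%E) ->
  (upper_box_dim V <= d%:E)%E.
Proof.
move=> d0 H; apply/lee_addgt0Pr => e e0; apply: ereal_inf_lbound.
by exists (d + e) => //; split; [lra|apply: H; lra].
Qed.

Lemma lower_box_dim_ge d V :
  (forall s, s < d -> lower_minkowski_content s V != 0%E) ->
  (d%:E <= lower_box_dim V)%E.
Proof.
move=> H; apply: le_ereal_inf_tmp => _ [s [s0 us] <-]; rewrite lee_fin leNgt.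
by apply/negP => /H; rewrite us eqxx.
Qed.

(** Bounding the upper dimension by arbitrarily small positive numbers is enough,
as both dimensions are nonnegative by definition. *)
Lemma has_box_dim0 V :
  (forall d, 0 < d < 1 -> exists2 C, 0 <= C & \forall e \near 0^'+,
    (lebesgue_measure (closed_nbhd V e) <= (C * e `^ (1 - d))%:E)%E) ->
  has_box_dim V 0.
Proof.
move=> H.
have U : (upper_box_dim V <= 0%:E)%E.
  apply: upper_box_dim_le => // s s0.
  have : 0 < Num.min s 1 <= 1 by rewrite lt_min s0 ltr01 ge_min lexx orbT.
  have : Num.min s 1 <= s by rewrite ge_min lexx.
  set d := Num.min s 1 => ds d01.
  have [C C0 /(upper_content_eq0 C0)] := H (d / 2) ltac:(lra).
  by apply; lra.
have L : (0%:E <= lower_box_dim V)%E.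
  by apply: le_ereal_inf_tmp => _ [s [s0 us] <-]; rewrite lee_fin.
have LU := lower_le_upper_box_dim V.
by split; apply/eqP; rewrite eq_le ?U ?L ?(le_trans LU)// (le_trans L).
Qed.

(** A two-sided estimate of the measure of the [e]-neighbourhood by the power
[1 - d] of [e] determines everything: the lower content is positive up to the
exponent [d] and the upper one vanishes beyond it. *)
Lemma has_box_dim_nondegenerate V d c C : 0 <= d -> 0 < c -> 0 <= C ->
  (\forall e \near 0^'+,
    ((c * e `^ (1 - d))%:E <= lebesgue_measure (closed_nbhd V e))%E) ->
  (\forall e \near 0^'+,
    (lebesgue_measure (closed_nbhd V e) <= (C * e `^ (1 - d))%:E)%E) ->
  minkowski_nondegenerate V /\ has_box_dim V d.
Proof.
move=> d0 c0 C0 Hc HC.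
have lo s : s <= d -> (0 < lower_minkowski_content s V)%E.
  by move=> /(lower_content_ge_bound c0 Hc); apply: lt_le_trans; rewrite lte_fin.
have U := upper_box_dim_le d0 (upper_content_eq0 C0 HC).
have L : (d%:E <= lower_box_dim V)%E.
  by apply: lower_box_dim_ge => s /ltW/lo /gt_eqF ->.
have LU := lower_le_upper_box_dim V; split; last first.
  by split; apply/eqP; rewrite eq_le ?U ?L ?(le_trans LU)// (le_trans L).
exists d; split=> //; [exact: lo|exact: lower_content_le_upper|].
by apply: le_lt_trans (upper_content_le_bound HC) _; rewrite ltry.
Qed.

End Contents.

(** * Neighbourhoods of sequences with controlled increments *)

Section Sequences.
Context {R : realType}.
Implicit Types (w v : nat -> R).

Lemma lebesgue_measure_itvcc (a b : R) : a <= b ->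
  lebesgue_measure (`[a, b]%classic : set R) = (b - a)%:E.
Proof.
move=> ab; rewrite lebesgue_measure_itv/= lte_fin; case: ltgtP ab => // -> _.
by rewrite subrr.
Qed.

(** Separates the tail of the sequence, between 0 and [r], from its first [K] terms,
each of which contributes an interval of length [4 * e]. *)
Lemma measure_nbhd_seq_le w (e r : R) (K : nat) : 0 < e -> 0 <= r ->
  (forall l, 0 < w l) -> (forall l, (K <= l)%N -> w l <= r) ->
  (lebesgue_measure (closed_nbhd (range w) e) <= (r + 4 * e * (K%:R + 1))%:E)%E.
Proof.
move=> e0 r0 w0 wr.
pose F k : set R := if k is j.+1 then `[w j - 2 * e, w j + 2 * e]%classic
                    else `[- (2 * e), r + 2 * e]%classic.
have mF k : measurable (F k) by case: k => [|k]; exact: measurable_itv.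
have sub : closed_nbhd (range w) e `<=` \big[setU/set0]_(k < K.+1) F k.
  move=> x /(closed_nbhd_near e0)[_ [l _ <-]]; rewrite ltr_norml => /andP[x1 x2].
  rewrite -bigcup_mkord; have [Kl|lK] := leqP K l.
    by exists 0%N => //=; rewrite in_itv/=; have := w0 l; have := wr _ Kl; lra.
  by exists l.+1 => //=; rewrite in_itv/=; lra.
have := content_subadditive lebesgue_measure (fun k _ => mF k)
  (measurable_closed_nbhd _ _) sub.
move=> /le_trans; apply.
rewrite big_ord_recl /= lebesgue_measure_itvcc; last lra.
rewrite (eq_bigr (fun=> (4 * e)%:E)); last first.
  move=> i _ /=; rewrite lebesgue_measure_itvcc ?lee_fin; last lra.
  by congr EFin; lra.
rewrite sumEFin sumr_const card_ord -EFinD lee_fin -mulr_natr; lra.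
Qed.

Lemma linear_growth (u : nat -> R) (c : R) (N : nat) :
  (forall l, (N <= l)%N -> c <= u l.+1 - u l) ->
  forall l, (N <= l)%N -> u N + c * (l - N)%:R <= u l.
Proof.
move=> H; elim=> [|l IH]; first by rewrite leqn0 => /eqP ->; rewrite subnn mulr0 addr0.
rewrite leq_eqVlt => /orP[/eqP <-|]; first by rewrite subnn mulr0 addr0.
rewrite ltnS => Nl; have := H _ Nl; have := IH Nl.
by rewrite subSn// -natr1 mulrDr mulr1; lra.
Qed.

(** By linear growth of [v l `^ m], the number of terms with [(v l)^-1 > r] is of
order [r `^ (- m)] at most.  At [r = e `^ (m + 1)^-1] the tail, of length [r],
and the intervals around these terms, of total length of order
[e * r `^ (- m) = r], balance each other. *)
Lemma measure_nbhd_upper v (m c : R) : 0 < m -> 0 < c -> (forall l, 0 < v l) ->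
  (\forall l \near \oo, c <= v l.+1 `^ m - v l `^ m) ->
  exists2 C, 0 <= C & \forall e \near 0^'+,
   (lebesgue_measure (closed_nbhd (range (fun l => (v l)^-1)%R) e)
     <= (C * e `^ (m + 1)^-1)%:E)%E.
Proof.
move=> m0 c0 v0 [N _ HN]; have m1 : 0 < m + 1 by lra.
(* The three terms bound the tail, the number of points above r, and the
   points before the index N at which growth starts. *)
exists (1 + 4 / c + 4 * (N%:R + 2)).
  by have := divr_ge0 (ler0n R 4) (ltW c0); have := ler0n R N; lra.
near=> e.
have e0 : 0 < e by near: e; exact: nbhs_right_gt.
have e1 : e < 1 by near: e; exact: nbhs_right_lt.
pose r := e `^ (m + 1)^-1; rewrite -/r.
have r0 : 0 < r by rewrite powR_gt0.
have re : e <= r.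
  by rewrite ger1_powR ?e0 ?(ltW e1)// invf_le1//; lra.
have rm : r `^ (m + 1) = e by rewrite -powRrM mulVf ?gt_eqF// powRr1 ?ltW.
(* From v N on, v l `^ m passes r^-1 `^ m after at most B steps. *)
pose B := r^-1 `^ m / c.
have B0 : 0 <= B by rewrite divr_ge0 ?powR_ge0 ?ltW.
have eB : e * B = r / c.
  rewrite -rm powRD ?(gt_eqF r0) ?implybT// powRr1 ?ltW// /B.
  rewrite -powR_inv1 ?ltW// -powRrM mulN1r powRN; field.
  by rewrite !gt_eqF ?powR_gt0.
pose K := (N + (Num.truncn B).+1)%N.
have HK l : (K <= l)%N -> (v l)^-1 <= r.
  move=> Kl; have Nl : (N <= l)%N by rewrite (leq_trans _ Kl)// leq_addr.
  have := linear_growth (u := fun l => v l `^ m) HN Nl => vl.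
  have : r^-1 `^ m < v l `^ m.
    have := powR_ge0 (v N) m; have : B < (l - N)%:R.
      apply: lt_le_trans (truncnS_gt B) _; rewrite ler_nat.
      by rewrite leq_subRL// addnC.
    by rewrite /B ltr_pdivrMr// mulrC; lra.
  have := v0 l; case: (lerP (v l)^-1 r) => // rv vl0.
  move/lt_geF => <-; apply: le_powR; rewrite ?ltW//.
  by rewrite -(invrK (v l)) ltf_pV2 ?posrE ?invr_gt0//.
have v'0 l : 0 < (v l)^-1 by rewrite invr_gt0.
apply: le_trans (measure_nbhd_seq_le e0 (ltW r0) v'0 HK) _.
rewrite lee_fin /K natrD -natr1.
have /andP[tB _] := truncn_itv B0.
have : e * (Num.truncn B)%:R <= r / c by rewrite -eB (ler_wpM2l (ltW e0)).
have : e * (N%:R + 2) <= r * (N%:R + 2) by rewrite ler_wpM2r// addr_ge0.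
set T := (Num.truncn B)%:R; rewrite -/T.
lra.
Unshelve. all: by end_near. Qed.

(** Since [m >= 1], bounded increments of [v l `^ m] give
[v l.+1 - v l <= C * v l `^ (1 - m)], hence gaps of order [w `^ (m + 1)] next to
the point [w = (v l)^-1].  Below a multiple of [e `^ (m + 1)^-1] the gaps are
smaller than [e] and the neighbourhood has no holes. *)
Lemma measure_nbhd_lower v (m C : R) : 1 <= m -> 0 < C -> (forall l, 0 < v l) ->
  (v l @[l --> \oo] --> +oo) -> (forall l, v l <= v l.+1) ->
  (\forall l \near \oo, v l.+1 `^ m - v l `^ m <= C) ->
  exists2 c, 0 < c & \forall e \near 0^'+,
   ((c * e `^ (m + 1)^-1)%:E <=
    lebesgue_measure (closed_nbhd (range (fun l => (v l)^-1)%R) e))%E.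
Proof.
move=> m1 C0 v0 voo vinc HC; have m0 : 0 < m + 1 by lra.
have [N _ HN] : \forall l \near \oo,
    v l.+1 `^ m - v l `^ m <= C /\ 1 + C <= v l.
  near=> l; split; first by near: l.
  by near: l; move/cvgryPge: voo; apply.
have gap l : (N <= l)%N -> v l.+1 - v l <= C * v l * v l `^ (- m).
  move=> /HN[H1 _]; pose q := v l.+1 / v l.
  have q1 : 1 <= q by rewrite ler_pdivlMr// mul1r.
  have vl : v l.+1 = v l * q by rewrite /q mulrCA divff ?mulr1// gt_eqF.
  (* A weak form of Bernoulli's inequality: for m >= 1 the increment of v l `^ m
   controls that of v l. *)
have qm : q <= q `^ m by exact: le1r_powR.
  move: H1; rewrite vl powRM ?(ltW (v0 l)) ?(le_trans ler01)// powRN => H1.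
  have p0 : 0 < v l `^ m by rewrite powR_gt0.
  have pq : (v l `^ m) * (q - 1) <= C.
    by apply: le_trans H1; rewrite mulrBr mulr1 lerB// (ler_wpM2l (ltW p0)).
  rewrite ler_pdivlMr// [leLHS](_ : _ * _ = v l * (v l `^ m * (q - 1))); last by ring.
  by rewrite [leRHS]mulrC (ler_wpM2l (ltW (v0 l))).
have dbl l : (N <= l)%N -> v l.+1 <= 2 * v l.
  move=> Nl; have := gap _ Nl; have [_ vl] := HN _ Nl.
  have : v l `^ (- m) <= (v l)^-1.
    by rewrite -powR_inv1 ?(ltW (v0 l))// ler_powR; lra.
  move=> /(ler_wpM2l (ltW (mulr_gt0 C0 (v0 l)))); rewrite mulfK ?gt_eqF//; lra.
(* Chosen so that x <= k * e `^ (m + 1)^-1 forces C * (2 * x) `^ (m + 1) <= e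
   / 2, a bound for the gap at x. *)
pose k := (2 `^ (m + 1) * C * 2) `^ (- (m + 1)^-1).
have k0 : 0 < k by rewrite powR_gt0// !mulr_gt0// powR_gt0.
have km : k `^ (m + 1) * (2 `^ (m + 1) * C) = 2^-1.
  rewrite /k -powRrM mulNr mulVf ?gt_eqF// powR_inv1 ?mulr_ge0 ?powR_ge0 ?ltW//.
  field; rewrite !gt_eqF// ?powR_gt0//.
exists (k / 2); first lra.
near=> e.
have e0 : 0 < e by near: e; exact: nbhs_right_gt.
pose r := k * e `^ (m + 1)^-1.
have rN : r <= (v N)^-1.
  rewrite /r -ler_pdivlMl//; near: e; apply: near_powR_le; first by rewrite invr_gt0.
  by rewrite mulr_gt0 ?invr_gt0.
have r0 : 0 < r by rewrite mulr_gt0// powR_gt0.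
have -> : (k / 2 * e `^ (m + 1)^-1)%:E = lebesgue_measure (`[r / 2, r]%classic : set R).
  by rewrite lebesgue_measure_itvcc; [congr EFin; rewrite /r; lra|lra].
apply: le_measure; rewrite ?inE; [exact: measurable_itv|exact: measurable_closed_nbhd|].
move=> x /=; rewrite in_itv/= => /andP[rx xr].
have x0 : 0 < x by lra.
(* The gap containing x ends at the first l with x^-1 < v l. *)
have exl : exists l, x^-1 < v (N + l)%N.
  have [M _ HM] : \forall l \near \oo, x^-1 + 1 <= v l by move/cvgryPge: voo; apply.
  by exists M; apply: lt_le_trans (HM (N + M)%N _); [lra|rewrite /= leq_addl].
have [l xl lmin] := ex_minnP exl.
have [j lj] : exists j, l = j.+1.
  case: l xl {lmin} => [|j _]; last by exists j.
  rewrite addn0 => xl; exfalso; move: xl; apply/negP; rewrite -leNgt.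
  by rewrite -(invrK (v N)) lef_pV2 ?posrE ?invr_gt0//; exact: le_trans rN.
have vj : v (N + j)%N <= x^-1.
  by rewrite leNgt; apply/negP => /lmin; rewrite lj ltnn.
move: xl; rewrite lj addnS; set i := (N + j)%N in vj * => xl.
have Ni : (N <= i)%N by rewrite leq_addr.
have w1 : (v i.+1)^-1 < x by rewrite -(invrK x) ltf_pV2 ?posrE ?invr_gt0.
have w2 : x <= (v i)^-1 by rewrite -(invrK x) lef_pV2 ?posrE ?invr_gt0.
apply: (@near_closed_nbhd _ _ _ _ (v i)^-1) => //.
rewrite ler0_norm ?subr_le0//.
have g := gap _ Ni; have d := dbl _ Ni.
have a1 : (v i)^-1 - (v i.+1)^-1 <= C * v i `^ (- (m + 1)).
  have -> : (v i)^-1 - (v i.+1)^-1 = (v i.+1 - v i) / (v i * v i.+1).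
    by field; rewrite !gt_eqF.
  rewrite opprD powRD ?(gt_eqF (v0 i)) ?implybT// powR_inv1 ?(ltW (v0 i))//.
  rewrite ler_pdivrMr ?mulr_gt0//; apply: le_trans g _.
  rewrite [leRHS](_ : _ = C * v i.+1 * v i `^ (- m)); last first.
    by field; rewrite gt_eqF.
  by rewrite ler_wpM2r ?powR_ge0// ler_wpM2l// ltW.
have a2 : v i `^ (- (m + 1)) < 2 `^ (m + 1) * x `^ (m + 1).
  rewrite -mulN1r powRrM powR_inv1 ?(ltW (v0 i))// -powRM ?(ltW x0)//.
  apply: lt_powR; rewrite ?invr_ge0 ?(ltW (v0 i))//.
  have : (v i)^-1 <= 2 * (v i.+1)^-1.
    by rewrite ler_pdivlMr// mulrC ler_pdivrMr.
  lra.
have a3 : x `^ (m + 1) <= k `^ (m + 1) * e.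
  have -> : k `^ (m + 1) * e = r `^ (m + 1).
    by rewrite powRM ?powR_ge0 ?(ltW k0)// -powRrM mulVf ?gt_eqF// powRr1 ?ltW.
  by apply: le_powR; rewrite ?(ltW m0) ?(ltW x0)//.
have a4 : C * (2 `^ (m + 1) * x `^ (m + 1)) <= e / 2.
  have : C * 2 `^ (m + 1) * x `^ (m + 1) <= C * 2 `^ (m + 1) * (k `^ (m + 1) * e).
    by rewrite ler_wpM2l// mulr_ge0 ?powR_ge0 ?ltW.
  rewrite -mulrA => /le_trans; apply; rewrite mulrA mulrC.
  by rewrite [_ * k `^ _]mulrC [C * _]mulrC km.
have a5 : C * v i `^ (- (m + 1)) < C * (2 `^ (m + 1) * x `^ (m + 1)).
  by rewrite ltr_pM2l.
lra.
Unshelve. all: by end_near. Qed.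

End Sequences.

(** * Polynomials at infinity and on the positive half-line *)

Section Limits.
Context {R : realType}.
Implicit Types (p q : {poly R}).

Lemma cvg_near_eq {T : Type} {F : set_system T} {FF : Filter F} (f g : T -> R) (l : R) :
  (\forall x \near F, f x = g x) -> g x @[x --> F] --> l -> f x @[x --> F] --> l.
Proof.
move=> fg; apply: cvg_trans; apply: near_eq_cvg.
by apply: filterS fg => x ->.
Qed.

Lemma cvg_expn {T : Type} {F : set_system T} {FF : Filter F} (f : T -> R) (l : R) k :
  f x @[x --> F] --> l -> f x ^+ k @[x --> F] --> l ^+ k.
Proof.
move=> fl; exact: (@continuous_cvg T R R F FF f (fun x => x ^+ k) l
  (@exprn_continuous R k l) fl).
Qed.

(** For [u >= 0] one has [`|1 - u| <= `|1 - u ^+ k|], as [1 - u] is a factor of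
[1 - u ^+ k] whose cofactor is at least 1. *)
Lemma cvg_root1 {T : Type} {F : set_system T} {FF : Filter F} (f : T -> R) k :
  (\forall x \near F, 0 <= f x) -> (0 < k)%N -> f x ^+ k @[x --> F] --> (1 : R) ->
  f x @[x --> F] --> (1 : R).
Proof.
move=> f0 k0 /cvgrPdist_le fk; apply/cvgrPdist_le => e e0.
near=> x; apply: le_trans (_ : `|1 - f x ^+ k| <= _); last by near: x; exact: fk.
have fx0 : 0 <= f x by near: x.
rewrite -[X in `|X - _ ^+ k|](expr1n R k) subrXX normrM ler_peMr//.
apply: le_trans (ler_norm _).
rewrite -(prednK k0) big_ord_recl /= expr0 expr1n mulr1.
rewrite lerDl sumr_ge0// => i _.
by rewrite mulr_ge0 ?exprn_ge0.
Unshelve. all: by end_near. Qed.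

(** Used for the intermediate points supplied by the mean value theorem: they are
equivalent to the ends of the interval as soon as the ends are equivalent to
each other. *)
Lemma cvg_between1 {T : Type} {F : set_system T} {FF : Filter F} (f g x : T -> R) :
  (\forall a \near F, 0 < f a) ->
  (\forall a \near F, Num.min (f a) (g a) <= x a <= Num.max (f a) (g a)) ->
  g a / f a @[a --> F] --> (1 : R) -> x a / f a @[a --> F] --> (1 : R).
Proof.
move=> f0 fxg /cvgrPdist_le gf; apply/cvgrPdist_le => e e0.
near=> a; apply: le_trans (_ : `|1 - g a / f a| <= _); last by near: a; exact: gf.
have fa0 : 0 < f a by near: a.
have E u : 1 - u / f a = (f a - u) / f a by rewrite mulrBl divff ?gt_eqF.
rewrite !E !normrM ler_wpM2r//.
have : Num.min (f a) (g a) <= x a <= Num.max (f a) (g a) by near: a.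
rewrite /Num.min /Num.max; case: ltP => fg /andP[h1 h2].
  by rewrite !ler0_norm; lra.
by rewrite !ger0_norm; lra.
Unshelve. all: by end_near. Qed.

Lemma cvg_invr_pinfty : x^-1 @[x --> +oo] --> (0 : R).
Proof.
apply/cvgrPdist_le => e e0; near=> x.
have x0 : 0 < x by near: x; exact: nbhs_pinfty_gt.
rewrite sub0r normrN ger0_norm ?invr_ge0 ?(ltW x0)// -(invrK e).
by rewrite lef_pV2 ?posrE ?invr_gt0//; near: x; exact: nbhs_pinfty_ge.
Unshelve. all: by end_near. Qed.

Lemma cvg_horner_lead p k : (size p <= k.+1)%N ->
  p.[x] / x ^+ k @[x --> +oo] --> p`_k.
Proof.
elim: k p => [|k IH] p sp.
  rewrite [p]size1_polyC// coefC eqxx.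
  by apply: cvg_near_cst; near=> x; rewrite hornerC expr0 divr1.
have: exists q c, p = q * 'X + c%:P by elim/poly_ind: p sp => [|q c _ _];
  [exists 0, 0; rewrite mul0r addr0|exists q, c].
move=> [q [c pE]].
have sq : (size q <= k.+1)%N.
  move: sp; rewrite pE size_MXaddC; case: ifP => // /andP[/eqP -> _].
  by rewrite size_poly0.
rewrite pE coefD coefMX coefC /= addr0.
have L : (q.[x] / x ^+ k + c * (x^-1 ^+ k * x^-1)) @[x --> +oo] --> q`_k + c * (0 ^+ k * 0).
  apply: cvgD; first exact: IH.
  apply: cvgM; first exact: cvg_cst.
  by apply: cvgM; [apply: cvg_expn|]; exact: cvg_invr_pinfty.
move: L; rewrite !mulr0 addr0 => L; apply: (cvg_near_eq _ L); near=> x.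
have x0 : x != 0 by rewrite gt_eqF//; near: x; exact: nbhs_pinfty_gt.
rewrite !hornerE /= exprVn exprS; field.
by rewrite x0 expf_neq0.
Unshelve. all: by end_near. Qed.

Lemma horner_pinfty p k : (0 < k)%N -> (size p <= k.+1)%N -> 0 < p`_k ->
  p.[x] @[x --> +oo] --> +oo.
Proof.
move=> k0 sp pk; have pl := cvg_horner_lead sp.
apply/cvgryPge => A; near=> x.
have x1 : 1 <= x by near: x; exact: nbhs_pinfty_ge.
have x0 : 0 < x by exact: lt_le_trans x1.
have : p`_k / 2 < p.[x] / x ^+ k.
  by near: x; apply: (cvgr_gt _ pl); rewrite ltr_pdivrMr// mulr2n mulrDr mulr1 ltrDl.
rewrite ltr_pdivlMr ?exprn_gt0// => /ltW; apply: le_trans.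
have : p`_k / 2 * x <= p`_k / 2 * x ^+ k.
  rewrite ler_wpM2l ?divr_ge0 ?(ltW pk)// -(prednK k0).
  by rewrite exprS ler_peMr ?(ltW x0)// exprn_ege1.
by apply: le_trans; rewrite -ler_pdivrMl ?divr_gt0.
Unshelve. all: by end_near. Qed.

(** The mean value theorem for the combination of [p] and [q] that takes the same
value at both ends. *)
Lemma poly_cauchy_mvt p q (a b : R) : exists2 c,
  Num.min a b <= c <= Num.max a b &
  (p.[b] - p.[a]) * q^`().[c] = (q.[b] - q.[a]) * p^`().[c].
Proof.
wlog ab : a b / a < b => [H|].
  have [->|] := eqVneq a b.
    by exists b; [rewrite minxx maxxx lexx|rewrite !subrr !mul0r].
  rewrite neq_lt => /orP[ab|ba]; first exact: H.
  have [c cab E] := H _ _ ba; exists c; first by rewrite minC maxC.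
  by apply: oppr_inj; rewrite -!mulNr !opprB.
pose r := (p.[b] - p.[a]) *: q - (q.[b] - q.[a]) *: p.
have [c /[!in_itv]/= /andP[ac cb] E] := poly_mvt r ab.
exists c; first by rewrite min_l ?max_r ?(ltW ab)// (ltW ac) (ltW cb).
move: E; rewrite /r derivB !derivZ !hornerE => E.
apply/eqP; rewrite -subr_eq0; have : b - a != 0 by rewrite subr_eq0 gt_eqF.
move=> /mulIf ba; apply/eqP/ba; rewrite -E mul0r; ring.
Qed.

Lemma coefM_top p q i j : (size p <= i.+1)%N -> (size q <= j.+1)%N ->
  (p * q)`_(i + j) = p`_i * q`_j.
Proof.
move=> sp sq; rewrite coefM.
have ii : (i < (i + j).+1)%N by rewrite ltnS leq_addr.
rewrite (bigD1 (Ordinal ii))//= addKn big1 ?addr0// => l li.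
have [il|il] := ltnP i l; first by rewrite (nth_default _ (leq_trans sp il)) mul0r.
have {il}li : (l < i)%N by rewrite ltn_neqAle il andbT.
rewrite [q`__]nth_default ?mulr0//; apply: leq_trans sq _.
by rewrite ltn_subRL ltn_add2r.
Qed.

End Limits.

Section Inverse.
Context {R : realType}.
Implicit Types (p : {poly R}) (x y t : R).

(** These conditions make [p] an increasing bijection of the half-line t >= 0. *)
Definition half_line_poly p :=
  [/\ p.[0] = 0, forall t, 0 < t -> 0 < p^`().[t] & p.[x] @[x --> +oo] --> +oo].

(** The inverse of [p] on the half-line, given by the same choice operator as the
points [alpha] and [omega] of the slow divergence integrals. *)
Definition pinv p y : R := xget 0 [set t | 0 < t /\ p.[t] = y].

Variable p : {poly R}.
Hypothesis hp : half_line_poly p.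

Lemma half_line_lt x y : 0 <= x -> x < y -> p.[x] < p.[y].
Proof.
have [p0 p' _] := hp; move=> x0 xy.
have [c /[!in_itv]/= /andP[xc _] E] := poly_mvt p xy.
by rewrite -subr_gt0 E mulr_gt0 ?subr_gt0// p'// (le_lt_trans x0).
Qed.

Lemma half_line_gt0 t : 0 < t -> 0 < p.[t].
Proof. by move=> t0; have [p0 _ _] := hp; rewrite -p0; exact: half_line_lt. Qed.

Lemma half_line_ltE x y : 0 <= x -> 0 <= y -> (p.[x] < p.[y]) = (x < y).
Proof.
move=> x0 y0; have [xy|yx|->] := ltgtP x y; last by rewrite ltxx.
  by rewrite half_line_lt.
by apply/negbTE; rewrite -leNgt ltW// half_line_lt.
Qed.

Lemma half_line_inj x y : 0 <= x -> 0 <= y -> p.[x] = p.[y] -> x = y.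
Proof.
move=> x0 y0 E; have [//|/lt_total/orP[] xy] := eqVneq x y.
  by have := half_line_lt x0 xy; rewrite E ltxx.
by have := half_line_lt y0 xy; rewrite E ltxx.
Qed.

Lemma pinvP y : 0 < y -> 0 < pinv p y /\ p.[pinv p y] = y.
Proof.
move=> y0; have [p0 _ /cvgryPge/(_ y) poo] := hp.
have [b [yb b0]] : exists b, y <= p.[b] /\ 0 <= b.
  near (+oo : set_system R) => b; exists b; split; first by near: b; exact: poo.
  by near: b; exact: nbhs_pinfty_ge.
have := @poly_ivt R (p - y%:P) 0 b b0; rewrite !hornerE p0 => H.
have {}H : exists2 x, x \in `[0, b] & root (p - y%:P) x.
  by apply: H; rewrite sub0r oppr_le0 (ltW y0) subr_ge0.
move: H => [t /[!in_itv]/= /andP[t0 _]]; rewrite /root !hornerE subr_eq0 => /eqP E.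
apply: (@xgetPex _ 0 [set t | 0 < t /\ p.[t] = y]); exists t; split=> //.
by rewrite lt_neqAle t0 andbT; apply: contraTneq y0 => t00; rewrite -E -t00 p0 ltxx.
Unshelve. all: by end_near. Qed.

Lemma pinv_gt0 y : 0 < y -> 0 < pinv p y. Proof. by case/pinvP. Qed.

Lemma horner_pinv y : 0 < y -> p.[pinv p y] = y. Proof. by case/pinvP. Qed.

Lemma pinvK t : 0 < t -> pinv p p.[t] = t.
Proof.
move=> t0; have [q0 qE] := pinvP (half_line_gt0 t0).
by apply: half_line_inj => //; rewrite ltW.
Qed.

Lemma pinv_lt x y : 0 < x -> 0 < y -> (pinv p x < pinv p y) = (x < y).
Proof.
move=> x0 y0; rewrite -half_line_ltE ?horner_pinv//; exact/ltW/pinv_gt0.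
Qed.

Lemma pinv_pinfty : pinv p y @[y --> +oo] --> +oo.
Proof.
apply/cvgryPge => A; near=> y.
have M0 : 0 < Num.max 1 A by rewrite lt_max ltr01.
have y0 : 0 < y by near: y; exact: nbhs_pinfty_gt.
have : Num.max 1 A <= pinv p y.
  rewrite leNgt -half_line_ltE ?(ltW M0) ?(ltW (pinv_gt0 y0))// horner_pinv//.
  rewrite -leNgt; near: y; apply: nbhs_pinfty_ge; exact: num_real.
by apply: le_trans; rewrite le_max lexx orbT.
Unshelve. all: by end_near. Qed.

Lemma pinv_continuous y : 0 < y -> {for y, continuous (pinv p)}.
Proof.
move=> y0; have [t0 tE] := pinvP y0.
have tpos : \forall t \near pinv p y, 0 < t by exact: lt_nbhsr.
have H : {near p.[pinv p y], continuous (pinv p)}.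
  apply: (@near_can_continuous R (horner p) (pinv p) (pinv p y)).
    rewrite /prop_near1; near=> t; apply: pinvK; near: t; exact: tpos.
  by near=> t; exact: continuous_horner.
by rewrite -{1}tE; exact: (nbhs_singleton H).
Unshelve. all: by end_near. Qed.

End Inverse.

(** * Divergence polynomials of a profile *)

Section Profiles.
Context {R : realType}.
Implicit Types (p q : {poly R}).

(** The quotient of [p^`()] by ['X], for [p] without linear term. *)
Definition slope_poly p : {poly R} := \poly_(i < (size p).-2) (p`_i.+2 *+ i.+2).

Definition primitive_poly q : {poly R} := \poly_(i < (size q).+1) (q`_i.-1 / i%:R).

(** A primitive of [p^`() ^+ 2 / 'X]: its value at the inverse image of [y] under [p]
is the slow divergence integral of [y] multiplied by [- a]. *)
Definition divergence_poly p := primitive_poly ('X * slope_poly p ^+ 2).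

Lemma coef_slope_poly p i : (slope_poly p)`_i = p`_i.+2 *+ i.+2.
Proof.
rewrite coef_poly; case: ltnP => // pi; rewrite nth_default ?mul0rn//.
by case: (size p) pi => [|[|k]].
Qed.

Lemma deriv_slope_poly p : p`_1 = 0 -> p^`() = 'X * slope_poly p.
Proof.
move=> p1; apply/polyP => i; rewrite coef_deriv coefXM coef_slope_poly.
by case: i => [|i] //=; rewrite p1 mul0rn.
Qed.

Lemma coef_primitive_poly q i : (primitive_poly q)`_i.+1 = q`_i / i.+1%:R.
Proof.
rewrite coef_poly ltnS; case: ltnP => // qi.
by rewrite nth_default ?mul0r.
Qed.

Lemma coef0_primitive_poly q : (primitive_poly q)`_0 = 0.
Proof. by rewrite coef_poly /= invr0 mulr0. Qed.

Lemma deriv_primitive_poly q : (primitive_poly q)^`() = q.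
Proof.
apply/polyP => i; rewrite coef_deriv coef_primitive_poly -(mulr_natr (q`_i / _)).
by rewrite mulfVK// pnatr_eq0.
Qed.

Lemma size_primitive_poly q k : (size q <= k)%N -> (size (primitive_poly q) <= k.+1)%N.
Proof. by move=> qk; apply: leq_trans (size_poly _ _) _. Qed.

(** A branch of the curve y = F(x), seen from the side t = |x| >= 0; the degree
[N.+2] is the number n + 1 of the system, so that N = n - 1. *)
Definition profile (N : nat) p :=
  [/\ (size p <= N.+3)%N, p`_N.+2 = 1, p`_0 = 0, p`_1 = 0 &
      forall t, 0 < t -> 0 < p^`().[t]].

Variables (N : nat) (p : {poly R}).
Hypothesis hp : profile N p.

Lemma profile_half_line : half_line_poly p.
Proof.
have [sp pN p0 p1 p'] := hp; split=> //; first by rewrite horner_coef0.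
by apply: (horner_pinfty (k := N.+2)) => //; rewrite pN.
Qed.

Lemma size_slope_poly : (size (slope_poly p) <= N.+1)%N.
Proof.
have [sp _ _ _ _] := hp; apply: leq_trans (size_poly _ _) _.
by move: sp; case: (size p) => [|[|k]].
Qed.

Lemma slope_poly_lead : (slope_poly p)`_N = N.+2%:R.
Proof. by have [_ pN _ _ _] := hp; rewrite coef_slope_poly pN. Qed.

Lemma profile_deriv : p^`() = 'X * slope_poly p.
Proof. by have [_ _ _ p1 _] := hp; exact: deriv_slope_poly. Qed.

Lemma slope_poly_gt0 t : 0 < t -> 0 < (slope_poly p).[t].
Proof.
have [_ _ _ _ p'] := hp; move=> t0; have := p' _ t0.
by rewrite profile_deriv !hornerE pmulr_rgt0.
Qed.

Lemma deriv_divergence_poly : (divergence_poly p)^`() = p^`() * slope_poly p.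
Proof. by rewrite deriv_primitive_poly profile_deriv expr2 mulrA. Qed.

Lemma size_divergence_poly : (size (divergence_poly p) <= (N.+1).*2.+1)%N.
Proof.
have sq := size_slope_poly.
apply: size_primitive_poly; apply: leq_trans (size_polyMleq _ _) _.
rewrite size_polyX expr2 /=; apply: leq_ltn_trans (size_polyMleq _ _) _.
by move: sq; lia.
Qed.

(** The leading coefficient is the same for all profiles of a given degree, so
that the ratio of the two divergence integrals at infinity only depends on the
coefficients of the slow drift. *)
Lemma divergence_poly_lead :
  (divergence_poly p)`_(N.+1).*2 = N.+2%:R ^+ 2 / (N.+1).*2%:R.
Proof.
rewrite doubleS coef_primitive_poly; congr (_ / _).
rewrite coefXM /= -addnn expr2 (coefM_top size_slope_poly size_slope_poly).
by rewrite slope_poly_lead expr2.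
Qed.

Lemma divergence_half_line : half_line_poly (divergence_poly p).
Proof.
have [_ _ _ _ p'] := hp; split.
- by rewrite horner_coef0 coef0_primitive_poly.
- by move=> t t0; rewrite deriv_divergence_poly hornerM mulr_gt0 ?p' ?slope_poly_gt0.
- apply: (horner_pinfty (k := (N.+1).*2)) => //; first exact: size_divergence_poly.
  by rewrite divergence_poly_lead divr_gt0 ?exprn_gt0// ltr0n.
Qed.

Lemma pinv_profile_cvg : y / pinv p y ^+ N.+2 @[y --> +oo] --> (1 : R).
Proof.
have [sp pN _ _ _] := hp; have := cvg_horner_lead sp; rewrite pN => L.
have {}L := cvg_comp _ _ (pinv_pinfty profile_half_line) L.
apply: (cvg_near_eq _ L); near=> y => /=.
by rewrite horner_pinv//; exact: profile_half_line.
Unshelve. all: by end_near. Qed.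

(** The reciprocal of the coordinate in which orbits near infinity are measured. *)
Definition nroot (y : R) := y `^ (N.+2%:R)^-1.

Lemma nroot_gt0 y : 0 < y -> 0 < nroot y.
Proof. exact: powR_gt0. Qed.

Lemma nrootK y : 0 < y -> nroot y ^+ N.+2 = y.
Proof.
move=> y0; rewrite -powR_mulrn ?powR_ge0// -powRrM mulVf ?powRr1 ?(ltW y0)//.
Qed.

Lemma nroot_pinv_cvg : nroot y / pinv p y @[y --> +oo] --> (1 : R).
Proof.
apply: (@cvg_root1 _ _ _ _ _ N.+2) => //.
  near=> y; rewrite divr_ge0 ?powR_ge0//.
  by apply: ltW; apply: pinv_gt0 => //; exact: profile_half_line.
apply: (cvg_near_eq _ pinv_profile_cvg); near=> y.
by rewrite expr_div_n nrootK.
Unshelve. all: by end_near. Qed.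

End Profiles.

(** * Escape of orbits to infinity *)

Section Orbits.
Context {R : realType}.

(** The sign of [JB - JA] cannot change beyond [ystar], so the eventual
inequality [y < h y] holds from [ystar] on and the orbit increases.  At a finite
limit the relation [JA (h y) = JB y] would give a common value of [JA] and [JB],
by continuity. *)
Lemma orbit_escapes (JA JB h : R -> R) (ystar : R) : 0 < ystar ->
  (forall y, 0 < y -> {for y, continuous JA}) ->
  (forall y, 0 < y -> {for y, continuous JB}) ->
  (forall x y, 0 < x -> 0 < y -> (JA x < JA y) = (x < y)) ->
  (forall y, 0 < y -> 0 < h y /\ JA (h y) = JB y) ->
  (forall y, ystar < y -> JA y != JB y) ->
  (\forall y \near +oo, y < h y) ->
  forall y0, ystar < y0 ->
  tends_monotonically_to_infinity (orbit_of h y0) /\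
  (forall l, 0 < orbit_of h y0 l).
Proof.
move=> ys0 cA cB JAlt hJ neq hgt y0 hy0.
have up y : ystar < y -> y < h y.
  move=> yy; have yp : 0 < y by exact: lt_trans yy.
  have [hp E] := hJ _ yp; rewrite -JAlt// E.
  have [z [yz zp hz]] : exists z, [/\ y <= z, 0 < z & z < h z].
    near (+oo : set_system R) => z; exists z; split=> //.
    by near: z.
  have [hzp Ez] := hJ _ zp; move: hz; rewrite -JAlt// Ez => hz.
  rewrite ltNge; apply/negP => BA.
  have : exists2 c, c \in `[y, z] & JB c - JA c = 0.
    apply: (@IVT _ (fun c => JB c - JA c)) => //.
      apply: continuous_in_subspaceT => c /set_mem /=; rewrite in_itv/= => /andP[yc _].
      have c0 : 0 < c by exact: lt_le_trans yc.
      by apply: continuousB; [exact: cB|exact: cA].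
    rewrite ge_min le_max; apply/andP; split; apply/orP; [left|right].
      by rewrite subr_le0.
    by rewrite subr_ge0 ltW.
  move=> [c /[!in_itv]/= /andP[yc _] /eqP]; rewrite subr_eq0 eq_sym.
  by rewrite (negbTE (neq _ (lt_le_trans yy yc))).
have big l : y0 <= orbit_of h y0 l.
  elim: l => [|l IH] //; apply: (le_trans IH); apply/ltW/up.
  exact: lt_le_trans IH.
have pos l : 0 < orbit_of h y0 l.
  exact: lt_le_trans (lt_trans ys0 hy0) (big l).
have mono : nondecreasing_seq (orbit_of h y0).
  apply/nondecreasing_seqP => l; apply/ltW/up; exact: lt_le_trans (big l).
split=> //; split=> //.
apply: nondecreasing_dvgn_lt => // cv; set z := limn (orbit_of h y0) in cv.
have yz : y0 <= z by exact: (nondecreasing_cvgn_le mono cv 0%N).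
have sz : ystar < z by exact: lt_le_trans yz.
have zp : 0 < z by exact: lt_trans sz.
have LB : JB (orbit_of h y0 l) @[l --> \oo] --> JB z.
  exact: (continuous_cvg _ (cB _ zp) cv).
have LA : JA (orbit_of h y0 l.+1) @[l --> \oo] --> JA z.
  by apply: (continuous_cvg _ (cA _ zp)); rewrite -cvg_shiftS in cv.
have E : (fun l => JA (orbit_of h y0 l.+1)) = (fun l => JB (orbit_of h y0 l)).
  by apply/funext => l; have [_ <-] := hJ _ (pos l).
rewrite E in LA; have zz : JA z = JB z by exact: (cvg_unique _ LA LB).
by have := neq _ sz; rewrite zz eqxx.
Unshelve. all: by end_near. Qed.

End Orbits.

(** * Asymptotics of the return map *)

Section ReturnMap.
Context {R : realType}.
Variables (N : nat) (A B : {poly R}) (q : R) (h : R -> R).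
Hypotheses (hA : profile N A) (hB : profile N B) (q0 : 0 < q).
Hypothesis hh : forall y, 0 < y -> 0 < h y /\
  (divergence_poly A).[pinv A (h y)] = q * (divergence_poly B).[pinv B y].

Let A' := profile_half_line hA.
Let B' := profile_half_line hB.
Let DA' := divergence_half_line hA.
Let DB' := divergence_half_line hB.

Lemma pinv_ratio_cvg : pinv B y / pinv A y @[y --> +oo] --> (1 : R).
Proof.
apply: (@cvg_root1 _ _ _ _ _ N.+2) => //.
  by near=> y; rewrite divr_ge0// ltW// pinv_gt0.
have L : (y / pinv A y ^+ N.+2) * (y / pinv B y ^+ N.+2)^-1 @[y --> +oo] --> (1 : R) * 1^-1.
  apply: cvgM; first exact: pinv_profile_cvg.
  by apply: cvgV; [exact: oner_neq0|exact: pinv_profile_cvg].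
rewrite invr1 mulr1 in L; apply: (cvg_near_eq _ L); near=> y.
have y0 : 0 < y by [].
rewrite expr_div_n; field.
by rewrite !expf_neq0// ?gt_eqF// ?pinv_gt0.
Unshelve. all: by end_near. Qed.

Lemma return_pinfty : h y @[y --> +oo] --> +oo.
Proof.
have [sA A2 _ _ _] := hA.
have LB : (divergence_poly B).[pinv B y] @[y --> +oo] --> +oo.
  by have [_ _ oo] := DB'; exact: (cvg_comp _ _ (pinv_pinfty B') oo).
have LqB : q * (divergence_poly B).[pinv B y] @[y --> +oo] --> +oo.
  apply/cvgryPge => C; near=> y; rewrite -ler_pdivrMl//.
  by near: y; move/cvgryPge: LB; apply.
have Lt := cvg_comp _ _ LqB (pinv_pinfty DA').
have [_ _ Aoo] := A'; have L := cvg_comp _ _ Lt Aoo.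
apply: cvg_trans L; apply: near_eq_cvg; near=> y.
have y0 : 0 < y by [].
by have [hy0 /= <-] := hh y0; rewrite (pinvK DA') ?horner_pinv// pinv_gt0.
Unshelve. all: by end_near. Qed.

Let M := (N.+1).*2.
Let K := (divergence_poly A)`_M.

(** Both [(divergence_poly A).[t]] and [(divergence_poly B).[t]] are equivalent to
the same multiple of [t ^+ M], and the two inverses of [y] are equivalent to each
other. *)
Lemma pinv_return_cvg : (pinv A (h y) / pinv A y) ^+ M @[y --> +oo] --> q.
Proof.
have KB : (divergence_poly B)`_M = K by rewrite /K (divergence_poly_lead hA) (divergence_poly_lead hB).
have K0 : K != 0 by rewrite /K (divergence_poly_lead hA) gt_eqF// divr_gt0 ?exprn_gt0// ltr0n.
have LA : (divergence_poly A).[pinv A (h y)] / pinv A (h y) ^+ M @[y --> +oo] --> K.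
  have L := cvg_horner_lead (size_divergence_poly hA).
  have {}L := cvg_comp _ _ (pinv_pinfty A') L.
  exact: (cvg_comp _ _ return_pinfty L).
have LB : (divergence_poly B).[pinv B y] / pinv B y ^+ M @[y --> +oo] --> K.
  have L := cvg_horner_lead (size_divergence_poly hB); rewrite KB in L.
  exact: (cvg_comp _ _ (pinv_pinfty B') L).
have L : q * ((divergence_poly B).[pinv B y] / pinv B y ^+ M) *
    (pinv B y / pinv A y) ^+ M *
    ((divergence_poly A).[pinv A (h y)] / pinv A (h y) ^+ M)^-1 @[y --> +oo]
  --> q * K * 1 ^+ M * K^-1.
  apply: cvgM; last exact: cvgV.
  apply: cvgM; last by apply: cvg_expn; exact: pinv_ratio_cvg.
  by apply: cvgM; [exact: cvg_cst|].
rewrite expr1n mulr1 mulfK// in L; apply: (cvg_near_eq _ L); near=> y.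
have y0 : 0 < y by [].
have [hy0 E] := hh y0; rewrite E !expr_div_n; field.
rewrite !expf_neq0 ?(gt_eqF q0) ?gt_eqF// ?(half_line_gt0 DB') ?pinv_gt0//.
Unshelve. all: by end_near. Qed.

Lemma nroot_return_cvg :
  (nroot N (h y) / nroot N y) ^+ M @[y --> +oo] --> q.
Proof.
have L1 : nroot N (h y) / pinv A (h y) @[y --> +oo] --> (1 : R).
  exact: (cvg_comp _ _ return_pinfty (nroot_pinv_cvg hA)).
have L : (nroot N (h y) / pinv A (h y)) ^+ M * (pinv A (h y) / pinv A y) ^+ M *
   (nroot N y / pinv A y)^-1 ^+ M @[y --> +oo] --> 1 ^+ M * q * 1^-1 ^+ M.
  apply: cvgM; last first.
    apply: cvg_expn; apply: cvgV; [exact: oner_neq0|exact: (nroot_pinv_cvg hA)].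
  by apply: cvgM; [exact: cvg_expn|exact: pinv_return_cvg].
rewrite invr1 expr1n mulr1 mul1r in L; apply: (cvg_near_eq _ L); near=> y.
have y0 : 0 < y by [].
have [hy0 E] := hh y0; rewrite -!exprMn; congr (_ ^+ _); field.
by rewrite !gt_eqF// ?nroot_gt0// ?pinv_gt0.
Unshelve. all: by end_near. Qed.

Lemma geometric_return : 1 < q ->
  exists2 r, 1 < r & \forall y \near +oo, r * nroot N y ^+ M <= nroot N (h y) ^+ M.
Proof.
move=> q1; exists ((1 + q) / 2); first lra.
near=> y; have y0 : 0 < y by [].
rewrite -ler_pdivlMr ?exprn_gt0 ?nroot_gt0// -expr_div_n; apply: ltW.
near: y; apply: (cvgr_gt _ nroot_return_cvg); lra.
Unshelve. all: by end_near. Qed.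

End ReturnMap.

Section BalancedReturn.
Context {R : realType}.
Variables (N j : nat) (A B : {poly R}) (h : R -> R).
Hypotheses (hA : profile N A) (hB : profile N B).
Hypothesis hh : forall y, 0 < y -> 0 < h y /\
  (divergence_poly A).[pinv A (h y)] = (divergence_poly B).[pinv B y].
Let f := (B - A)`_j.+2.
Hypotheses (jN : (j < N)%N) (sBA : (size (B - A)%R <= j.+3)%N).

Let A' := profile_half_line hA.
Let B' := profile_half_line hB.
Let hh1 : forall y, 0 < y -> 0 < h y /\
  (divergence_poly A).[pinv A (h y)] = 1 * (divergence_poly B).[pinv B y].
Proof. by move=> y /hh; rewrite mul1r. Qed.

Lemma slope_gap_size : (size (slope_poly B - slope_poly A)%R <= j.+1)%N.
Proof.
apply/leq_sizeP => i ji; rewrite coefB !coef_slope_poly -mulrnBl -coefB.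
by rewrite (leq_sizeP _ _ sBA) ?mul0rn.
Qed.

Lemma slope_sum_size : (size (slope_poly B + slope_poly A)%R <= N.+1)%N.
Proof.
by apply: leq_trans (size_polyD _ _) _; rewrite geq_max !size_slope_poly.
Qed.

(** The derivative of the difference of the divergence polynomials is
['X * (QB ^+ 2 - QA ^+ 2)] for the slopes [QA] and [QB]; the factor [QB - QA] has
the low degree of [B - A]. *)
Lemma coef_divergence_gap i :
  (divergence_poly B - divergence_poly A)`_i.+2 =
  ((slope_poly B - slope_poly A) * (slope_poly B + slope_poly A))`_i / i.+2%:R.
Proof.
by rewrite coefB !coef_primitive_poly -mulrBl !coefXM /= -coefB mulrC -subr_sqr mulrC.
Qed.

Lemma divergence_gap_size :
  (size (divergence_poly B - divergence_poly A)%R <= (j + N).+3)%N.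
Proof.
apply/leq_sizeP => -[|[|i]] // ji; rewrite coef_divergence_gap nth_default ?mul0r//.
apply: leq_trans (size_polyMleq _ _) _.
by have := slope_gap_size; have := slope_sum_size; lia.
Qed.

(** Its sign is that of [f * (1 + k0 - n)], as [k0 = j.+2] and [n = N.+1]. *)
Definition gap_const : R := f * N.+2%:R * (j.+2%:R - N%:R) / (j + N).+2%:R.

Lemma divergence_gap_lead :
  (divergence_poly B - divergence_poly A)`_(j + N).+2
    = 2 * j.+2%:R * N.+2%:R * f / (j + N).+2%:R.
Proof.
rewrite coef_divergence_gap (coefM_top slope_gap_size slope_sum_size).
rewrite coefB coefD (slope_poly_lead hA) (slope_poly_lead hB) !coef_slope_poly.
rewrite -mulrnBl -coefB -/f -mulr_natr; congr (_ / _); ring.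
Qed.

Lemma pinv_return_cvg1 : pinv A (h y) / pinv A y @[y --> +oo] --> (1 : R).
Proof.
apply: (@cvg_root1 _ _ _ _ _ (N.+1).*2) => //; last exact: pinv_return_cvg hh1.
near=> y; have y0 : 0 < y by []; have [hy0 _] := hh y0.
by rewrite divr_ge0// ltW// pinv_gt0.
Unshelve. all: by end_near. Qed.

Lemma slope_between_cvg p (x : R -> R) : profile N p ->
  x y / pinv A y @[y --> +oo] --> (1 : R) ->
  (slope_poly p).[x y] / pinv A y ^+ N @[y --> +oo] --> (N.+2%:R : R).
Proof.
move=> hp xt.
have xoo : x y @[y --> +oo] --> +oo.
  apply/cvgryPge => C; near=> y; have y0 : 0 < y by [].
  have t0 := pinv_gt0 A' y0.
  have : 2^-1 < x y / pinv A y by near: y; apply: (cvgr_gt _ xt); lra.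
  rewrite ltr_pdivlMr//; have : 2 * C <= pinv A y.
    by near: y; move/cvgryPge: (pinv_pinfty A'); apply.
  lra.
have L : (slope_poly p).[x y] / x y ^+ N * (x y / pinv A y) ^+ N @[y --> +oo]
    --> N.+2%:R * (1 : R) ^+ N.
  apply: cvgM; last exact: cvg_expn.
  have := cvg_horner_lead (size_slope_poly hp); rewrite (slope_poly_lead hp) => L.
  exact: (cvg_comp _ _ xoo L).
rewrite expr1n mulr1 in L; apply: (cvg_near_eq _ L); near=> y.
have y0 : 0 < y by [].
have x0 : 0 < x y by near: y; move/cvgryPgt: xoo; apply.
rewrite expr_div_n; field.
by rewrite !expf_neq0 ?gt_eqF// pinv_gt0.
Unshelve. all: by end_near. Qed.

(** The derivative of [divergence_poly p] is [p^`() * slope_poly p], so Cauchy's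
theorem compares the increments of [divergence_poly p] and [p] through the slope. *)
Lemma divergence_cauchy_mvt p (a b : R) : profile N p -> 0 < a -> 0 < b ->
  exists2 c, Num.min a b <= c <= Num.max a b &
  (divergence_poly p).[b] - (divergence_poly p).[a] =
    (p.[b] - p.[a]) * (slope_poly p).[c].
Proof.
move=> hp a0 b0; have [c cab E] := poly_cauchy_mvt (divergence_poly p) p a b.
exists c => //; have c0 : 0 < c.
  by have /andP[+ _] := cab; apply: lt_le_trans; rewrite lt_min a0.
have [_ _ _ _ /(_ _ c0) p'] := hp.
apply: (mulIf (lt0r_neq0 p')); rewrite E (deriv_divergence_poly hp) hornerM; ring.
Qed.

(** By definition of [h] the increment equals [DB (s) - DA (t)] at the inverses [s]
and [t] of [y] under [B] and [A], with [DA] and [DB] the divergence polynomials.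
It splits into [DB (t) - DA (t)], a polynomial with known leading term, and
[DB (s) - DB (t) = (B (s) - B (t)) * QB (c)], where [B (s) = A (t)] turns the first
factor into [- (B - A) (t)]. *)
Lemma divergence_increment_cvg :
  ((divergence_poly A).[pinv A (h y)] - (divergence_poly A).[pinv A y])
   / pinv A y ^+ (j + N).+2 @[y --> +oo] --> gap_const.
Proof.
have /choice[xi Hxi] : forall y, exists c, 0 < y ->
    Num.min (pinv A y) (pinv B y) <= c <= Num.max (pinv A y) (pinv B y) /\
    (divergence_poly B).[pinv B y] - (divergence_poly B).[pinv A y] =
    (B.[pinv B y] - B.[pinv A y]) * (slope_poly B).[c].
  move=> y; case: (ltP 0 y) => y0; last by exists 0.
  have [c c1 c2] := divergence_cauchy_mvt hB (pinv_gt0 A' y0) (pinv_gt0 B' y0).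
  by exists c.
have xt : xi y / pinv A y @[y --> +oo] --> (1 : R).
  apply: (cvg_between1 _ _ (pinv_ratio_cvg hA hB)).
    by near=> y; exact: pinv_gt0.
  by near=> y; have [] := Hxi y _.
have Lf : (B - A).[pinv A y] / pinv A y ^+ j.+2 @[y --> +oo] --> f.
  exact: (cvg_comp _ _ (pinv_pinfty A') (cvg_horner_lead sBA)).
have LG : (divergence_poly B - divergence_poly A).[pinv A y] / pinv A y ^+ (j + N).+2
    @[y --> +oo] --> 2 * j.+2%:R * N.+2%:R * f / (j + N).+2%:R.
  rewrite -divergence_gap_lead.
  exact: (cvg_comp _ _ (pinv_pinfty A') (cvg_horner_lead divergence_gap_size)).
(* The two parts of the increment add up to gap_const. *)
have -> : gap_const =
    2 * j.+2%:R * N.+2%:R * f / (j + N).+2%:R - f * N.+2%:R.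
  rewrite /gap_const; have : (j + N).+2%:R != 0 :> R by rewrite pnatr_eq0.
  by rewrite -!natr1 natrD => ?; field.
have L : (divergence_poly B - divergence_poly A).[pinv A y] / pinv A y ^+ (j + N).+2 -
    ((B - A).[pinv A y] / pinv A y ^+ j.+2) * ((slope_poly B).[xi y] / pinv A y ^+ N)
    @[y --> +oo] --> 2 * j.+2%:R * N.+2%:R * f / (j + N).+2%:R - f * N.+2%:R.
  by apply: cvgB => //; apply: cvgM => //; exact: slope_between_cvg.
apply: (cvg_near_eq _ L); near=> y; have y0 : 0 < y by [].
have [_ E] := Hxi y y0; have [_ ->] := hh y0.
rewrite (_ : (divergence_poly B).[_] = (divergence_poly B).[pinv A y] +
  (B.[pinv B y] - B.[pinv A y]) * (slope_poly B).[xi y]); last by rewrite -E; ring.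
have -> : B.[pinv B y] = A.[pinv A y] by rewrite !horner_pinv.
rewrite !(hornerD, hornerN).
rewrite -!addSn exprD; field.
by rewrite !expf_neq0 ?gt_eqF// pinv_gt0.
Unshelve. all: by end_near. Qed.

Lemma return_increment_cvg :
  (h y - y) / pinv A y ^+ j.+2 @[y --> +oo] --> gap_const / N.+2%:R.
Proof.
have /choice[xi Hxi] : forall y, exists c, 0 < y ->
    Num.min (pinv A y) (pinv A (h y)) <= c <= Num.max (pinv A y) (pinv A (h y)) /\
    (divergence_poly A).[pinv A (h y)] - (divergence_poly A).[pinv A y] =
    (h y - y) * (slope_poly A).[c].
  move=> y; case: (ltP 0 y) => y0; last by exists 0.
  have [hy0 _] := hh y0.
  have [c c1] := divergence_cauchy_mvt hA (pinv_gt0 A' y0) (pinv_gt0 A' hy0).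
  by rewrite !horner_pinv// => c2; exists c.
have xt : xi y / pinv A y @[y --> +oo] --> (1 : R).
  apply: (cvg_between1 _ _ pinv_return_cvg1).
    by near=> y; exact: pinv_gt0.
  by near=> y; have [] := Hxi y _.
have L : ((divergence_poly A).[pinv A (h y)] - (divergence_poly A).[pinv A y])
   / pinv A y ^+ (j + N).+2 * ((slope_poly A).[xi y] / pinv A y ^+ N)^-1
   @[y --> +oo] --> gap_const / N.+2%:R.
  apply: cvgM; first exact: divergence_increment_cvg.
  by apply: cvgV; [rewrite pnatr_eq0|exact: slope_between_cvg].
apply: (cvg_near_eq _ L); near=> y; have y0 : 0 < y by [].
have t0 := pinv_gt0 A' y0; have [hy0 _] := hh y0.
have [/andP[x1 _] ->] := Hxi y y0.
have x0 : 0 < xi y by apply: lt_le_trans x1; rewrite lt_min t0 pinv_gt0.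
rewrite -!addSn exprD; field.
by rewrite !expf_neq0 ?gt_eqF// (slope_poly_gt0 hA).
Unshelve. all: by end_near. Qed.

(** Cauchy's theorem for the powers [N - j] and [N.+2] on the interval between the
two roots: the power [N.+2] of [nroot] is the identity, and the increment
[h y - y] is known. *)
Lemma nroot_increment_cvg :
  nroot N (h y) ^+ (N - j) - nroot N y ^+ (N - j) @[y --> +oo] -->
    gap_const * (N - j)%:R / N.+2%:R ^+ 2.
Proof.
have [i Nij] : exists i, (N - j)%N = i.+1.
  by exists (N - j).-1; rewrite prednK// subn_gt0.
have NE : N.+1 = (j.+2 + i)%N by move: Nij jN; lia.
have /choice[xi Hxi] : forall y, exists c, 0 < y ->
    Num.min (nroot N y) (nroot N (h y)) <= c <= Num.max (nroot N y) (nroot N (h y)) /\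
    (nroot N (h y) ^+ i.+1 - nroot N y ^+ i.+1) * (N.+2%:R * c ^+ N.+1) =
    (h y - y) * (i.+1%:R * c ^+ i).
  move=> y; case: (ltP 0 y) => y0; last by exists 0.
  have [hy0 _] := hh y0.
  have [c c1] := poly_cauchy_mvt 'X^(i.+1) 'X^(N.+2) (nroot N y) (nroot N (h y)).
  rewrite !derivXn !hornerMn !hornerXn !nrootK// => c2; exists c => _; split => //.
  by rewrite !mulr_natl.
have xv : xi y / nroot N y @[y --> +oo] --> (1 : R).
  apply: (@cvg_between1 _ _ _ _ _ (fun y => nroot N (h y))).
  - by near=> y; exact: nroot_gt0.
  - by near=> y; have [] := Hxi y _.
  - apply: (@cvg_root1 _ _ _ _ _ (N.+1).*2) => //; last first.
      exact: (nroot_return_cvg hA hB ltr01 hh1).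
    by near=> y; rewrite divr_ge0 ?powR_ge0.
have xt : xi y / pinv A y @[y --> +oo] --> (1 : R).
  have L : xi y / nroot N y * (nroot N y / pinv A y) @[y --> +oo] --> (1 : R) * 1.
    by apply: cvgM => //; exact: nroot_pinv_cvg.
  rewrite mulr1 in L; apply: (cvg_near_eq _ L); near=> y; have y0 : 0 < y by [].
  by field; rewrite !gt_eqF// ?nroot_gt0// pinv_gt0.
rewrite Nij.
have L : (h y - y) / pinv A y ^+ j.+2 * (i.+1%:R / N.+2%:R) * (xi y / pinv A y)^-1 ^+ j.+2
   @[y --> +oo] --> gap_const / N.+2%:R * (i.+1%:R / N.+2%:R) * 1^-1 ^+ j.+2.
  apply: cvgM; last by apply: cvg_expn; apply: cvgV => //; exact: oner_neq0.
  by apply: cvgM; [exact: return_increment_cvg|exact: cvg_cst].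
have E : gap_const / N.+2%:R * (i.+1%:R / N.+2%:R) * 1^-1 ^+ j.+2 =
    gap_const * i.+1%:R / N.+2%:R ^+ 2.
  by rewrite invr1 expr1n; field; rewrite -natrD pnatr_eq0.
rewrite E in L; apply: (cvg_near_eq _ L); near=> y; have y0 : 0 < y by [].
have [/andP[x1 _] E2] := Hxi y y0; have [hy0 _] := hh y0.
have x0 : 0 < xi y by apply: lt_le_trans x1; rewrite lt_min !nroot_gt0.
have t0 := pinv_gt0 A' y0.
have nz : N.+2%:R * xi y ^+ N.+1 != 0 by rewrite mulf_neq0 ?expf_neq0 ?gt_eqF.
apply: (mulIf nz); rewrite E2 NE exprD exprVn expr_div_n; field.
by rewrite !expf_neq0 ?gt_eqF// -!natrD -nat1r pnatr_eq0.
Unshelve. all: by end_near. Qed.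

End BalancedReturn.

(** * Dimension of the orbits *)

Section OrbitDimension.
Context {R : realType}.
Implicit Types (p A B : {poly R}) (a b y : R).

Definition divergence_integral p a y := (divergence_poly p).[pinv p y] / a.

Section OneSide.
Variables (N : nat) (p : {poly R}) (a : R).
Hypotheses (hp : profile N p) (a0 : 0 < a).

Let p' := profile_half_line hp.
Let D' := divergence_half_line hp.

Lemma divergence_integral_lt x y : 0 < x -> 0 < y ->
  (divergence_integral p a x < divergence_integral p a y) = (x < y).
Proof.
move=> x0 y0; rewrite /divergence_integral ltr_pM2r ?invr_gt0//.
by rewrite half_line_ltE ?pinv_lt ?(ltW (pinv_gt0 p' _)).
Qed.

Lemma divergence_integral_gt0 y : 0 < y -> 0 < divergence_integral p a y.
Proof. by move=> y0; rewrite divr_gt0// half_line_gt0// pinv_gt0. Qed.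

Lemma divergence_integral_continuous y : 0 < y ->
  {for y, continuous (divergence_integral p a)}.
Proof.
move=> y0; rewrite /divergence_integral.
have L : (divergence_poly p).[pinv p z] @[z --> y] --> (divergence_poly p).[pinv p y].
  exact: (continuous_cvg _ (@continuous_horner _ _ _) (pinv_continuous p' y0)).
by apply: cvgM => //; exact: cvg_cst.
Qed.

(** This is what makes the slow relation, defined by choice, solve its equation. *)
Lemma divergence_integral_surj c : 0 < c ->
  exists2 y, 0 < y & divergence_integral p a y = c.
Proof.
move=> c0; have ac : 0 < a * c by rewrite mulr_gt0.
have t0 := pinv_gt0 D' ac; exists p.[pinv (divergence_poly p) (a * c)].
  exact: half_line_gt0.
rewrite /divergence_integral pinvK// horner_pinv//; field; exact: lt0r_neq0.
Qed.

End OneSide.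

Lemma orbit_at_infinityE N (u : nat -> R) :
  orbit_at_infinity N.+1 (range u) = range (fun l => (nroot N (u l))^-1).
Proof.
apply/seteqP; split => x /=.
  by move=> [_ [l _ <-] <-]; exists l => //; rewrite powRN.
by move=> [l _ <-]; exists (u l); [exists l|rewrite powRN].
Qed.

Lemma nroot_lt N x y : 0 < x -> 0 < y -> nroot N x < nroot N y -> x < y.
Proof.
move=> x0 y0; apply: contraTT; rewrite -!leNgt => yx.
by apply: le_powR; rewrite ?invr_ge0// ltW.
Qed.

Lemma nroot_pinfty N (u : nat -> R) : (forall l, 0 < u l) ->
  u l @[l --> \oo] --> +oo -> nroot N (u l) @[l --> \oo] --> +oo.
Proof.
move=> u0 uoo; apply/cvgryPge => C; near=> l.
have C1 : 0 < Num.max 1 C by rewrite lt_max ltr01.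
apply: (@le_trans _ _ (Num.max 1 C)); first by rewrite le_max lexx orbT.
have : Num.max 1 C ^+ N.+2 <= u l by near: l; move/cvgryPge: uoo; apply.
move=> /(le_powR (r := (N.+2%:R)^-1)); rewrite invr_ge0 ler0n exprn_ge0 ?(ltW C1)//.
move=> /(_ isT isT); apply: le_trans.
by rewrite -powR_mulrn ?(ltW C1)// -powRrM mulfV// powRr1 ?(ltW C1).
Unshelve. all: by end_near. Qed.

Section TwoSides.
Variables (N : nat) (A B : {poly R}) (a b : R) (h : R -> R) (ystar y0 : R).
Hypotheses (hA : profile N A) (hB : profile N B) (a0 : 0 < a) (b0 : 0 < b).
Hypothesis hJ : forall y, 0 < y -> 0 < h y /\
  divergence_integral A a (h y) = divergence_integral B b y.
Hypotheses (ys0 : 0 < ystar) (ysy0 : ystar < y0).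
Hypothesis neq : forall y, ystar < y ->
  divergence_integral A a y != divergence_integral B b y.

Let U := orbit_of h y0.
Let v l := nroot N (U l).

Lemma slow_orbit_escapes : (\forall y \near +oo, y < h y) ->
  tends_monotonically_to_infinity U /\ (forall l, 0 < U l).
Proof.
move=> hgt.
exact: (orbit_escapes ys0 (divergence_integral_continuous (a := a) hA)
  (divergence_integral_continuous (a := b) hB) (divergence_integral_lt hA a0)
  hJ neq hgt ysy0).
Qed.

(** Multiplying [v ^+ (2 n)] by at least [r > 1] at each step makes every power
[v `^ m] with [m > 0] increase by at least a positive constant, so the dimension
is at most [m / (m + 1)] for all [m > 0]. *)
Lemma unbalanced_orbit : b < a ->
  tends_monotonically_to_infinity U /\ has_box_dim (orbit_at_infinity N.+1 (range U)) 0.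
Proof.
move=> ba; have q0 : 0 < a / b by rewrite divr_gt0.
have q1 : 1 < a / b by rewrite ltr_pdivlMr// mul1r.
have hh y : 0 < y -> 0 < h y /\
    (divergence_poly A).[pinv A (h y)] = a / b * (divergence_poly B).[pinv B y].
  move=> y00; have [hy E] := hJ y00; split=> //.
  apply: (mulIf (invr_neq0 (lt0r_neq0 a0))); rewrite -[LHS]/(divergence_integral A a (h y)).
  by rewrite E /divergence_integral; field; rewrite !gt_eqF.
have [r r1 Hr] := geometric_return hA hB q0 hh q1.
have [] := slow_orbit_escapes.
  near=> y; have y00 : 0 < y by []; have [hy _] := hJ y00.
  apply: (@nroot_lt N) => //; rewrite -(@ltr_pXn2r _ (N.+1).*2) ?nnegrE ?powR_ge0//.
  have : r * nroot N y ^+ (N.+1).*2 <= nroot N (h y) ^+ (N.+1).*2 by near: y.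
  by apply: lt_le_trans; rewrite ltr_pMl// exprn_gt0// nroot_gt0.
move=> Umono U0; have [_ Uoo] := Umono; split=> //; rewrite orbit_at_infinityE.
have v0 l : 0 < v l by exact: nroot_gt0.
apply: has_box_dim0 => d /andP[d0 d1]; pose m := d / (1 - d).
have m0 : 0 < m by rewrite divr_gt0// subr_gt0.
(* The exponent m = d / (1 - d) is the one whose estimate gives the dimension
   d. *)
have -> : 1 - d = (m + 1)^-1 by rewrite /m; field; apply/andP; split; lra.
pose M := (N.+1).*2%:R : R; have M0 : 0 < M by rewrite ltr0n.
have s1 : 1 < r `^ (m / M).
  have := lt_powR (divr_gt0 m0 M0) ler01 r1.
  by rewrite powR1.
apply: (@measure_nbhd_upper _ v m (r `^ (m / M) - 1)) => //; first by rewrite subr_gt0.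
near=> l.
have vv : r * v l ^+ (N.+1).*2 <= v l.+1 ^+ (N.+1).*2.
  by near: l; exact: (Uoo _ Hr).
have vl1 : 1 <= v l by near: l; move/cvgryPge: (nroot_pinfty N U0 Uoo); apply.
have r0 : 0 <= r by lra.
have : r `^ (m / M) * v l `^ m <= v l.+1 `^ m.
  have pM x : 0 <= x -> x `^ m = (x ^+ (N.+1).*2) `^ (m / M).
    move=> x0; rewrite -powR_mulrn// -powRrM -/M; congr (_ `^ _).
    by field; exact: lt0r_neq0.
  rewrite (pM (v l)) ?(ltW (v0 l))// (pM (v l.+1)) ?(ltW (v0 l.+1))//.
  rewrite -powRM ?exprn_ge0 ?(ltW (v0 l))//; apply: le_powR => //.
    by rewrite divr_ge0 ?(ltW m0) ?(ltW M0).
  by rewrite mulr_ge0 ?exprn_ge0 ?(ltW (v0 l)).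
have vm1 : 1 <= v l `^ m by have := le_powR (ltW m0) ler01 vl1; rewrite powR1.
have := mulr_ge0 (_ : 0 <= r `^ (m / M) - 1) (_ : 0 <= v l `^ m - 1).
rewrite !subr_ge0 vm1 (ltW s1) => /(_ isT isT); lra.
Unshelve. all: by end_near. Qed.

(** The increments of [v ^+ m], for [m = N - j], converge to a positive number; they
are bounded on both sides, which gives matching estimates of the neighbourhoods. *)
Lemma balanced_orbit j : a = b -> (j < N)%N -> (size (B - A)%R <= j.+3)%N ->
  0 < (B - A)`_j.+2 * (j.+2%:R - N%:R) ->
  let d := (N - j)%:R / (N - j).+1%:R in
  [/\ tends_monotonically_to_infinity U,
      minkowski_nondegenerate (orbit_at_infinity N.+1 (range U)) &
      has_box_dim (orbit_at_infinity N.+1 (range U)) d].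
Proof.
move=> ab jN sBA f0 d.
have hh y : 0 < y -> 0 < h y /\
    (divergence_poly A).[pinv A (h y)] = (divergence_poly B).[pinv B y].
  move=> y00; have [hy E] := hJ y00; split=> //.
  by apply: (mulIf (invr_neq0 (lt0r_neq0 a0))); rewrite {2}ab; exact: E.
set m := (N - j)%N in d *; have m_gt0 : (0 < m)%N by rewrite subn_gt0.
have L := nroot_increment_cvg hA hB hh jN sBA; rewrite -/m in L.
set lam := gap_const _ _ _ _ * _ / _ in L.
have lam0 : 0 < lam.
  rewrite /lam /gap_const !divr_gt0 ?exprn_gt0 ?ltr0n// mulr_gt0 ?ltr0n//.
  by rewrite divr_gt0 ?ltr0n// mulrAC mulr_gt0 ?ltr0n.
have [] := slow_orbit_escapes.
  near=> y; have y00 : 0 < y by []; have [hy _] := hh y y00.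
  apply: (@nroot_lt N) => //; rewrite -(@ltr_pXn2r _ m) ?nnegrE ?powR_ge0//.
  by rewrite -subr_gt0; near: y; exact: (cvgr_gt _ L).
move=> Umono U0; have [_ Uoo] := Umono.
have v0 l : 0 < v l by exact: nroot_gt0.
have vL : v l.+1 `^ m%:R - v l `^ m%:R @[l --> \oo] --> lam.
  under eq_fun do rewrite !powR_mulrn ?(ltW (v0 _))//.
  exact: (cvg_comp _ _ Uoo L).
have mp : 0 < m%:R :> R by rewrite ltr0n.
have [c c0 Hc] : exists2 c, 0 < c & \forall e \near 0^'+, ((c * e `^ (m%:R + 1)^-1)%:E <=
    lebesgue_measure (closed_nbhd (range (fun l => (v l)^-1)%R) e))%E.
  apply: (@measure_nbhd_lower _ v m%:R (lam + 1)) => //.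
  - by rewrite ler1n.
  - lra.
  - exact: nroot_pinfty.
  - move=> l; apply: le_powR; rewrite ?invr_ge0 ?(ltW (U0 l))//.
    by have [+ _] := Umono; move=> /nondecreasing_seqP; apply.
  - near=> l; apply/ltW; near: l; apply: (cvgr_lt _ vL); lra.
have [C C0 HC] : exists2 C, 0 <= C & \forall e \near 0^'+,
    (lebesgue_measure (closed_nbhd (range (fun l => (v l)^-1)%R) e) <=
     (C * e `^ (m%:R + 1)^-1)%:E)%E.
  apply: (@measure_nbhd_upper _ v m%:R (lam / 2)) => //; first by rewrite divr_gt0.
  near=> l; apply/ltW; near: l; apply: (cvgr_gt _ vL); lra.
have dE : (m%:R + 1)^-1 = 1 - d.
  by rewrite /d -natr1; field; rewrite natr1 pnatr_eq0.
rewrite dE in Hc HC.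
have d0 : 0 <= d by rewrite divr_ge0.
have [] := has_box_dim_nondegenerate d0 c0 C0 Hc HC.
by rewrite orbit_at_infinityE; split.
Unshelve. all: by end_near. Qed.

End TwoSides.
End OrbitDimension.

(** * Slow divergence integrals and slow relations *)

Section SlowDivergence.
Context {R : realType}.
Implicit Types (p : {poly R}) (b c : nat -> R) (a x y : R).

Definition lienard_poly n c : {poly R} :=
  \poly_(i < n.+2) (if i == n.+1 then 1 else if (2 <= i)%N then c i else 0).

(** The coefficients of F_-(- t) as a polynomial in t. *)
Definition reflect_coef b k : R := (-1) ^+ k * b k.

Lemma coef_lienard_poly n c i : (2 <= i <= n)%N -> (lienard_poly n c)`_i = c i.
Proof.
move=> /andP[i2 ni]; rewrite coef_poly ltnS (leqW ni) i2.
by rewrite ltn_eqF.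
Qed.

Lemma Fplus_horner n b : (0 < n)%N -> Fplus n b = horner (lienard_poly n b).
Proof.
move=> n0; apply/funext => x; rewrite /Fplus horner_poly big_ord_recr /= eqxx mul1r addrC.
congr (_ + _); rewrite -(big_mkord xpredT (fun i =>
  (if i == n.+1 then 1 else if (2 <= i)%N then b i else 0) * x ^+ i)).
rewrite [RHS]big_ltn// [X in _ = _ + X]big_ltn ?ltnS//= eqSS (ltn_eqF n0) !mul0r !add0r.
by apply: eq_big_nat => i /andP[i2 ni]; rewrite (ltn_eqF ni) i2.
Qed.

Lemma Fminus_horner n b : (0 < n)%N ->
  Fminus n b = horner (lienard_poly n (reflect_coef b) \Po (- 'X)).
Proof.
move=> n0; apply/funext => x; rewrite horner_comp !hornerE -Fplus_horner//.
rewrite /Fminus /Fplus (exprNn x); congr (_ + _); apply: eq_big_nat => i _.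
rewrite /reflect_coef (exprNn x) -[LHS]mul1r -[X in X * _ = _](sqrr_sign R i).
by rewrite expr2 mulrACA !mulrA.
Qed.

Lemma profile_lienard N c :
  (forall t, 0 < t -> 0 < (lienard_poly N.+1 c)^`().[t]) ->
  profile N (lienard_poly N.+1 c).
Proof.
move=> p'; split=> //; first exact: size_poly.
- by rewrite coef_poly ltnSn eqxx.
- by rewrite coef_poly.
- by rewrite coef_poly.
Qed.

Lemma Rintegral_deriv_poly p (u v : R) : u < v ->
  \int[lebesgue_measure]_(x in `[u, v]) p^`().[x] = p.[v] - p.[u].
Proof.
move=> uv; rewrite /Rintegral (@continuous_FTC2 R _ (horner p) u v) //.
- by apply: continuous_in_subspaceT => x _; exact: continuous_horner.
- split.
  + by move=> x _; exact: derivable_horner.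
  + by apply: cvg_at_right_filter; exact: continuous_horner.
  + by apply: cvg_at_left_filter; exact: continuous_horner.
- by move=> x _; rewrite derivE.
Qed.

Variables (N : nat) (a : R).

(** At [x = 0] the quotient [F'^2 / G] is 0 / 0 = 0, which agrees with the value of
the polynomial that it equals elsewhere; the integral is then that of the
derivative of a polynomial. *)
Lemma Iplus_divergence b : profile N (lienard_poly N.+1 b) ->
  forall y, 0 < y ->
  Iplus N.+1 a b y = - divergence_integral (lienard_poly N.+1 b) a y.
Proof.
move=> hp y y0; set p := lienard_poly _ _ in hp *.
have p' := profile_half_line hp; have t0 := pinv_gt0 p' y0.
have D0 : (divergence_poly p).[0] = 0 by have [] := divergence_half_line hp.
have -> : Iplus N.+1 a b y = slow_divergence_integral (horner p) (Gfun a) (pinv p y).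
  by rewrite /Iplus /omega /pinv !Fplus_horner.
rewrite /slow_divergence_integral /oriented_integral leNgt t0 /= opprK.
rewrite (_ : (fun x => _) = horner ((- a^-1) *: divergence_poly p)^`()).
  by rewrite Rintegral_deriv_poly// !hornerZ D0 mulr0 subr0 mulNr mulrC.
apply/funext => x; rewrite -derivE (profile_deriv hp) derivZ.
rewrite (deriv_divergence_poly hp) (profile_deriv hp) hornerZ !hornerM hornerX /Gfun.
have [->|x0] := eqVneq x 0; first by rewrite !(mul0r, mulr0) expr0n /= mul0r.
have [->|a0] := eqVneq a 0; first by rewrite !(oppr0, mul0r, mulr0, invr0).
by field; rewrite x0 a0.
Qed.

Lemma alpha_pinv b y : profile N (lienard_poly N.+1 (reflect_coef b)) -> 0 < y ->
  alpha N.+1 b y = - pinv (lienard_poly N.+1 (reflect_coef b)) y.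
Proof.
move=> hp y0; set p := lienard_poly _ _ in hp *.
have p' := profile_half_line hp; have [t0 tE] := pinvP p' y0.
have FE x : Fminus N.+1 b x = p.[- x].
  by rewrite Fminus_horner// horner_comp !hornerE.
have [x0 xE] : alpha N.+1 b y < 0 /\ Fminus N.+1 b (alpha N.+1 b y) = y.
  apply: (@xgetPex _ 0 [set x | x < 0 /\ Fminus N.+1 b x = y]).
  by exists (- pinv p y); rewrite /= oppr_lt0 FE opprK.
apply: oppr_inj; rewrite opprK; rewrite FE in xE.
by apply: (half_line_inj p'); rewrite ?oppr_ge0 ?(ltW x0) ?(ltW t0) ?xE ?tE.
Qed.

Lemma Iminus_divergence b : profile N (lienard_poly N.+1 (reflect_coef b)) ->
  forall y, 0 < y ->
  Iminus N.+1 a b y = - divergence_integral (lienard_poly N.+1 (reflect_coef b)) a y.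
Proof.
move=> hp y y0; rewrite /Iminus (alpha_pinv hp y0) Fminus_horner//.
set p := lienard_poly _ _ in hp *.
have p' := profile_half_line hp; have t0 := pinv_gt0 p' y0.
have D0 : (divergence_poly p).[0] = 0 by have [] := divergence_half_line hp.
rewrite /slow_divergence_integral /oriented_integral oppr_le0 (ltW t0).
rewrite (_ : (fun x => _) = horner ((- a^-1) *: (divergence_poly p \Po (- 'X)))^`()).
  rewrite Rintegral_deriv_poly ?oppr_lt0// !hornerZ !horner_comp !hornerN !hornerX opprK.
  by rewrite oppr0 D0 mulr0 sub0r mulNr opprK mulrC.
have dX : (- 'X : {poly R})^`() = -1 by rewrite derivN derivX.
apply/funext => x; rewrite -derivE derivZ !deriv_comp dX.
rewrite (deriv_divergence_poly hp) (profile_deriv hp).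
rewrite hornerZ !hornerM !horner_comp !hornerM !hornerN !hornerX hornerC /Gfun.
have [->|x0] := eqVneq x 0.
  by rewrite oppr0 !(mul0r, mulr0) expr0n /= mul0r.
have [->|a0] := eqVneq a 0; first by rewrite !(oppr0, mul0r, mulr0, invr0).
by field; rewrite x0 a0.
Qed.

End SlowDivergence.

Lemma profile_Fplus (R : realType) (N : nat) (b : nat -> R) :
  (forall x, 0 < x -> 0 < derive1 (Fplus N.+1 b) x) ->
  profile N (lienard_poly N.+1 b).
Proof. by move=> F'; apply: profile_lienard => t /F'; rewrite Fplus_horner// -derivE. Qed.

Lemma profile_Fminus (R : realType) (N : nat) (b : nat -> R) :
  (forall x, x < 0 -> derive1 (Fminus N.+1 b) x < 0) ->
  profile N (lienard_poly N.+1 (reflect_coef b)).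
Proof.
move=> F'; apply: profile_lienard => t t0; have := F' (- t).
rewrite oppr_lt0 t0 Fminus_horner// -derivE deriv_comp derivN derivX => /(_ isT).
by rewrite hornerM horner_comp !hornerN hornerX hornerC opprK mulrN1 oppr_lt0.
Qed.

Section SlowRelations.
Context {R : realType}.
Variables (N : nat) (am ap : R) (bm bp : nat -> R).
Hypotheses (am0 : 0 < am) (ap0 : 0 < ap).
Let A := lienard_poly N.+1 (reflect_coef bm).
Let B := lienard_poly N.+1 bp.
Hypotheses (hA : profile N A) (hB : profile N B).

Lemma slow_relationP y : 0 < y ->
  let z := slow_relation (Iminus N.+1 am bm) (Iplus N.+1 ap bp) y in
  0 < z /\ divergence_integral A am z = divergence_integral B ap y.
Proof.
move=> y0 z.
have [z0] : 0 < z /\ Iminus N.+1 am bm z = Iplus N.+1 ap bp y.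
  apply: (@xgetPex _ 0 [set z | 0 < z /\ Iminus N.+1 am bm z = Iplus N.+1 ap bp y]).
  have [x x0 xE] := divergence_integral_surj hA am0 (divergence_integral_gt0 hB ap0 y0).
  by exists x; split => //; rewrite (Iminus_divergence _ hA)// (Iplus_divergence _ hB)// xE.
by rewrite (Iminus_divergence _ hA)// (Iplus_divergence _ hB)// => /oppr_inj.
Qed.

Lemma slow_relation_invP y : 0 < y ->
  let z := slow_relation_inv (Iminus N.+1 am bm) (Iplus N.+1 ap bp) y in
  0 < z /\ divergence_integral B ap z = divergence_integral A am y.
Proof.
move=> y0 z.
have [z0] : 0 < z /\ Iminus N.+1 am bm y = Iplus N.+1 ap bp z.
  apply: (@xgetPex _ 0 [set z | 0 < z /\ Iminus N.+1 am bm y = Iplus N.+1 ap bp z]).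
  have [x x0 xE] := divergence_integral_surj hB ap0 (divergence_integral_gt0 hA am0 y0).
  by exists x; split => //; rewrite (Iminus_divergence _ hA)// (Iplus_divergence _ hB)// xE.
by rewrite (Iminus_divergence _ hA)// (Iplus_divergence _ hB)// => /oppr_inj.
Qed.

(** The reflection of the left side accounts for the alternating sign in [fcoef]. *)
Lemma coef_lienard_gap k : (2 <= k <= N.+1)%N -> (B - A)`_k = fcoef bm bp k.
Proof.
move=> kN; rewrite coefB !coef_lienard_poly// /fcoef /reflect_coef exprS.
by rewrite mulN1r mulNr.
Qed.

Lemma size_lienard_gap j :
  (forall k, (j.+2 < k <= N.+1)%N -> fcoef bm bp k = 0) ->
  (size (B - A)%R <= j.+3)%N.
Proof.
move=> f0; apply/leq_sizeP => i ji; have [iN|Ni] := leqP i N.+1.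
  by rewrite coef_lienard_gap ?f0 ?ji ?iN// andbT (leq_trans _ ji).
move: Ni; rewrite leq_eqVlt => /orP[/eqP <-|Ni].
  by rewrite coefB !coef_poly ltnSn eqxx subrr.
by rewrite coefB !nth_default ?subrr// (leq_trans (size_poly _ _)).
Qed.

End SlowRelations.

(** * Orbits of the slow relation of the system *)

Theorem theorem3p4 (R : realType) (n : nat) (am ap : R) (bm bp : nat -> R)
    (hn : (1 <= n)%N) (ham : 0 < am) (hap : 0 < ap)
    (hb2 : (2 <= n)%N -> 0 < bm 2%N /\ 0 < bp 2%N)
    (hFm : forall x : R, x < 0 -> derive1 (Fminus n bm) x < 0)
    (hFp : forall x : R, 0 < x -> 0 < derive1 (Fplus n bp) x) :
  let Im := Iminus n am bm in
  let Ip := Iplus n ap bp in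
  let H := slow_relation Im Ip in
  let Hinv := slow_relation_inv Im Ip in
  let f := fcoef bm bp in
  let V := fun y : nat -> R => orbit_at_infinity n (range y) in
  forall (ystar : R), 0 < ystar ->
  (forall y : R, ystar < y -> Ip y - Im y != 0) ->
  forall (y0 : R), ystar < y0 ->
  let U := orbit_of H y0 in
  let Uinv := orbit_of Hinv y0 in
  (am != ap ->
    (ap < am ->
      tends_monotonically_to_infinity U /\ has_box_dim (V U) 0) /\
    (am < ap ->
      tends_monotonically_to_infinity Uinv /\ has_box_dim (V Uinv) 0)) /\
  (am = ap ->
    forall k0 : nat, (2 <= k0 <= n)%N -> f k0 != 0 ->
    (forall k : nat, (k0 < k <= n)%N -> f k = 0) ->
    k0 <> (n - 1)%N ->
    let d := (n%:R + 1 - k0%:R) / (n%:R + 2 - k0%:R) : R in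
    (0 < f k0 * (1 + k0%:R - n%:R) ->
      [/\ tends_monotonically_to_infinity U,
          minkowski_nondegenerate (V U) & has_box_dim (V U) d]) /\
    (f k0 * (1 + k0%:R - n%:R) < 0 ->
      [/\ tends_monotonically_to_infinity Uinv,
          minkowski_nondegenerate (V Uinv) & has_box_dim (V Uinv) d])).
Proof.
case: n hn hb2 hFm hFp => // N _ _ hFm hFp /=.
move=> ystar ys0 neqI y0 ysy0.
pose A := lienard_poly N.+1 (reflect_coef bm); pose B := lienard_poly N.+1 bp.
have hA : profile N A by exact: profile_Fminus.
have hB : profile N B by exact: profile_Fplus.
have neq y : ystar < y -> divergence_integral A am y != divergence_integral B ap y.
  move=> yy; have yp : 0 < y by exact: lt_trans yy.
  have := neqI _ yy; rewrite (Iminus_divergence _ hA)// (Iplus_divergence _ hB)//.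
  by rewrite opprK addrC subr_eq0.
have neq' y : ystar < y -> divergence_integral B ap y != divergence_integral A am y.
  by move=> /neq; rewrite eq_sym.
have HP := slow_relationP ham hap hA hB.
have HIP := slow_relation_invP ham hap hA hB.
split=> [_|amp k0 /andP[k2 kn] fk0 fk k0n].
  split=> [pm|mp].
    exact: (unbalanced_orbit hA hB ham hap HP ys0 ysy0 neq pm).
  exact: (unbalanced_orbit hB hA hap ham HIP ys0 ysy0 neq' mp).
case: k0 k2 kn fk0 fk k0n => [|[|j]] // _ jN fk0 fk jn.
rewrite subn1 /= in jn.
have jN' : (j < N)%N by move: jN jn; lia.
have sBA := size_lienard_gap (N := N) fk.
have sAB : (size (A - B)%R <= j.+3)%N by rewrite -opprB size_polyN.
have fE : (B - A)`_j.+2 = fcoef bm bp j.+2 by apply: coef_lienard_gap; rewrite jN.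
have fE' : (A - B)`_j.+2 = - fcoef bm bp j.+2 by rewrite -opprB coefN fE.
have -> : (N.+1%:R + 1 - j.+2%:R) / (N.+1%:R + 2 - j.+2%:R) =
    (N - j)%:R / (N - j).+1%:R :> R.
  by rewrite -[(N - j).+1]addn1 natrD natrB ?(ltnW jN')// -!natr1; congr (_ / _); ring.
have sgn : 1 + j.+2%:R - N.+1%:R = j.+2%:R - N%:R :> R by rewrite -(natr1 N); ring.
rewrite sgn; split=> f0.
  by apply: (balanced_orbit hA hB ham HP ys0 ysy0 neq amp jN' sBA); rewrite fE.
apply: (balanced_orbit hB hA hap HIP ys0 ysy0 neq' (esym amp) jN' sAB).
by rewrite fE' mulNr oppr_gt0.
Qed.
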